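(* Let $M<L\le K$. For each $\gamma>1$ let $h_\gamma>0$ be such that $\mathsf{E}_\infty[\sigma_{(L-M)}(h_\gamma)]=\gamma$. Then $\tau_{(L)}(h_\gamma)\in\mathcal{C}_\gamma$. If, additionally, $|\mathcal{B}|\ge L$, then as $\gamma\to\infty$ $$\mathcal{J}_{\mathcal{B}}\left[\tau_{(L)}(h_\gamma)\right]\sim\frac{\log\gamma}{\mathcal{I}}.$$
   Context: Setting. There are $K$ sensors, indexed by $[K]=\{1,\ldots,K\}$; $\mathbb{N}=\{1,2,\ldots\}$; $M\ge 0$ is an integer with $M<K$. An arbitrary fixed subset $\mathcal{N}\subseteq[K]$ of size $|\mathcal{N}|=K-M$ consists of honest sensors; the remaining $M$ sensors are corrupt. $X_t^k$ is the observation of sensor $k$ at time $t\in\mathbb{N}$. $f,g$ are known densities with respect to a $\sigma$-finite measure $\lambda$, with $0<\mathcal{I}:=\int \log(g/f)\,g\,d\lambda<\infty$. The change occurs at a deterministic time $\nu\in\{0,1,\ldots\}$ in a subset $\mathcal{B}\subseteq\mathcal{N}$: the variables $X_t^k$, $k\in\mathcal{N}$, $t\in\mathbb{N}$, are independent, and $X_t^k$ has density $g$ if $k\in\mathcal{B}$ and $t>\nu$, and density $f$ otherwise. Adversary. A strategy is a family $\pi=\{\pi_t\}_{t\in\mathbb{N}}$ of deterministic Borel functions (which may depend on $\mathcal{N},\nu,\mathcal{B}$) such that the corrupt observations at time $t$ are $(X_t^k)_{k\notin\mathcal{N}}=\pi_t\big((X_s^j)_{j\in\mathcal{N},\,1\le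 s\le t}\big)$. $\mathsf{P}_\nu^{\mathcal{B},\pi}$ is the resulting probability measure, and $\mathsf{P}_\infty^{\pi}$ is the measure when no change ever occurs in the honest sensors; expectations are $\mathsf{E}_\nu^{\mathcal{B},\pi}$, $\mathsf{E}_\infty^\pi$. The superscript $\pi$ is dropped for quantities depending only on honest observations. Criteria. $\mathcal{F}_t=\sigma(X_s^k:1\le s\le t,\,k\in[K])$. A detection rule is an $\{\mathcal{F}_t\}$-stopping time $T$. $$\mathcal{J}_{\mathcal{B}}[T]=\sup_{\nu,\pi}\ \operatorname{ess\,sup}\ \mathsf{E}_\nu^{\mathcal{B},\pi}[(T-\nu)^+\mid\mathcal{F}_\nu],\qquad \mathcal{A}[T]=\inf_\pi \mathsf{E}_\infty^\pi[T],\qquad \mathcal{C}_\gamma=\{T:\mathcal{A}[T]\ge\gamma\}.$$ Alarm times. $\ell_t^k=\log\big(g(X_t^k)/f(X_t^k)\big)$, $Y_0^k=0$, $Y_t^k=(Y_{t-1}^k+\ell_t^k)^+$ for $k\in[K]$; $\tau_k(h)=\inf\{t\in\mathbb{N}:Y_t^k\ge h\}$. $\tau_{(1)}(h)\le\cdots\le\tau_{(K)}(h)$ are the ordered values of $\tau_k(h)$, $k\in[K]$, and $\sigma_{(1)}(h)\le\cdots\le\sigma_{(|\mathcal{N}|)}(h)$ are the ordered values of $\tau_k(h)$ over the honest sensors $k\in\mathcal{N}$ only. $x\sim y$ means $x/y\to1$. *)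

(* Defs.v *)
(* MathComp-Analysis. *)
From HB Require Import structures.
From mathcomp Require Import all_boot all_order all_algebra.
From mathcomp Require Import all_classical all_reals all_analysis.
From mathcomp Require Import measurable_realfun ess_sup_inf.

Set Implicit Arguments.
Unset Strict Implicit.
Unset Printing Implicit Defensive.

Import Order.TTheory GRing.Theory Num.Theory.
Import numFieldNormedType.Exports.

Local Open Scope classical_set_scope.
Local Open Scope ring_scope.
Local Open Scope ereal_scope.

Section probability_notions.
Context {R : realType} {d dE : measure_display}.
Context {Omega : measurableType d} {E : measurableType dE}.

Definition sigma_of (I T : Type) (D : set I) (Z : I -> T -> E) :
    set (set T) :=
  <<s \bigcup_(i in D) preimage_set_system setT (Z i) measurable >>.

Definition mutually_independent (I : eqType) (P : probability Omega R)
    (D : set I) (Z : I -> Omega -> E) : Prop :=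
  forall s : seq I, uniq s -> {subset s <= D} ->
  forall A : I -> set E, (forall i, measurable (A i)) ->
    P (\bigcap_(i in [set` s]) (Z i @^-1` A i)) =
    \prod_(i <- s) P (Z i @^-1` A i).

Definition is_density (lambda : set E -> \bar R) (f : E -> R) : Prop :=
  [/\ measurable_fun setT f, (forall x, (0 <= f x)%R) &
      \int[lambda]_x (f x)%:E = 1].

(* Conditional expectation of a nonnegative, possibly infinite, variable; it is
   determined only up to a P-null set. *)
Definition is_cond_exp (P : probability Omega R) (G : set (set Omega))
    (Z Y : Omega -> \bar R) : Prop :=
  [/\ (forall w, 0 <= Y w),
      (forall B : set (\bar R), measurable B -> G (Y @^-1` B)) &
      (forall A, G A -> \int[P]_(w in A) Y w = \int[P]_(w in A) Z w)].

End probability_notions.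

Section detection.
Context {R : realType} {d dE : measure_display}.
Context {Omega : measurableType d} {E : measurableType dE}.
Variable K : nat.

(* x t k is the observation of sensor k at time t; times start at 1, so that
   x 0 never plays any role. *)
Definition obs_path : Type := nat -> 'I_K -> E.

(* F_t on the space of paths; F_0 is trivial. *)
Definition filtration (t : nat) : set (set obs_path) :=
  sigma_of [set i : nat * 'I_K | (0 < i.1 <= t)%N]
    (fun i (x : obs_path) => x i.1 i.2).

Definition stopping_time (T : obs_path -> \bar R) : Prop :=
  (forall x, T x = +oo \/ exists n : nat, T x = n%:R%:E) /\
  (forall t : nat, filtration t [set x | T x <= t%:R%:E]).

Section adversary.
Variable N : {set 'I_K}.

(* The observations of the sensors in N at the times 1, ..., t, the time s : 'I_t
   standing for s + 1. *)
Definition history (t : nat) : Type := 'I_t -> {k : 'I_K | k \in N} -> E.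

(* pi t y k is used only for t >= 1 and k outside N. *)
Definition is_strategy (pi : forall t, history t -> 'I_K -> E) : Prop :=
  forall t k (A : set E), measurable A ->
    sigma_of setT
      (fun (i : 'I_t * {k : 'I_K | k \in N}) (y : history t) => y i.1 i.2)
      [set y | A (pi t y k)].

Definition attack (pi : forall t, history t -> 'I_K -> E) (x : obs_path) :
    obs_path :=
  fun t k => if k \in N then x t k
             else pi t (fun s j => x s.+1 (val j)) k.

(* The law of the honest observations when the sensors in B change from f to g
   at time nu; nu = None means that no change ever occurs. *)
Definition honest_law (lambda : set E -> \bar R) (f g : E -> R)
    (X : Omega -> obs_path) (B : {set 'I_K}) (nu : option nat)
    (P : probability Omega R) : Prop :=
  mutually_independent P [set i : nat * 'I_K | (0 < i.1)%N && (i.2 \in N)]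
    (fun i w => X w i.1 i.2) /\
  (forall t k (A : set E), (0 < t)%N -> k \in N -> measurable A ->
    let changed := if nu is Some n then (k \in B) && (n < t)%N else false in
    P [set w | A (X w t k)] =
    \int[lambda]_(x in A) ((if changed then g else f) x)%:E).

(* X is the honest process (its coordinates outside N are irrelevant) and P nu
   its law, so that attack pi \o X under P nu realizes P_nu^{B,pi}. *)
Variables (X : Omega -> obs_path) (P : option nat -> probability Omega R).

Definition worst_delay (T : obs_path -> \bar R) : \bar R :=
  ereal_sup [set v | exists (nu : nat) pi (Y : Omega -> \bar R),
    [/\ is_strategy pi,
        is_cond_exp (P (Some nu))
          (preimage_set_system setT (attack pi \o X) (filtration nu))
          (fun w => maxe (T (attack pi (X w)) - nu%:R%:E) 0) Y &
        v = ess_sup (P (Some nu)) Y]].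

Definition worst_false_alarm (T : obs_path -> \bar R) : \bar R :=
  ereal_inf [set \int[P None]_w T (attack pi (X w)) | pi in is_strategy].

Definition admissible (gamma : R) : set (obs_path -> \bar R) :=
  [set T | stopping_time T /\ gamma%:E <= worst_false_alarm T].

End adversary.

Section alarms.
Variables f g : E -> R.

(* The value is -oo when g x = 0, and +oo when f x = 0 < g x. *)
Definition llr (x : E) : \bar R := lne ((g x)%:E / (f x)%:E).

Fixpoint cusum (x : obs_path) (k : 'I_K) (t : nat) : \bar R :=
  if t is s.+1 then maxe (cusum x k s + llr (x t k)) 0 else 0.

Definition alarm (h : R) (k : 'I_K) (x : obs_path) : \bar R :=
  ereal_inf [set t%:R%:E | t in [set t | (0 < t)%N /\ h%:E <= cusum x k t]].

(* The j-th smallest entry of s, for 1 <= j <= size s. *)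
Definition order_stat (j : nat) (s : seq (\bar R)) : \bar R :=
  nth +oo (sort <=%O s) j.-1.

Definition alarm_all (j : nat) (h : R) (x : obs_path) : \bar R :=
  order_stat j [seq alarm h k x | k <- enum 'I_K].

Definition alarm_honest (N : {set 'I_K}) (j : nat) (h : R) (x : obs_path) :
    \bar R :=
  order_stat j [seq alarm h k x | k <- enum N].

End alarms.

End detection.

(* The relative entropy of g with respect to f. *)
Definition KL {R : realType} {dE : measure_display} {E : measurableType dE}
    (lambda : set E -> \bar R) (f g : E -> R) : \bar R :=
  \int[lambda]_x (llr f g x * (g x)%:E).

(* Main.v *)
Require Import Defs.
From HB Require Import structures.
From mathcomp Require Import all_boot all_order all_algebra.
From mathcomp Require Import all_classical all_reals all_analysis.
From mathcomp Require Import measurable_realfun ess_sup_inf.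
From mathcomp Require Import ring lra.
Import Order.TTheory GRing.Theory Num.Theory.
Import numFieldNormedType.Exports.

(** At most M of the first L alarms come from corrupt sensors. Whatever the
    adversary does, the L-th alarm is therefore not earlier than the (L - M)-th
    honest alarm, the mean of which is gamma (alarm_honest_le_all); this is the
    false alarm constraint.

    For the delay, write I for the relative entropy. The mean time of the
    (L - M)-th honest alarm without a change is of order e^h up to a factor
    e^(o(h)), so that log gamma ~ h, and the worst delay is ~ h / I. Everything
    reduces to one sensor, and to the statistic
    Z_t = max (Z_{t-1} phi(X_t)) 1, which for phi = g / f is the exponential of
    the CUSUM statistic. Let l = log (g / f) and let th > 0 be small.

    - If phi has mean at most a, then Z crosses the level b by time n with
      probability at most (n + 1) a^n / b (crossing_probability_le). Under f, with
      phi = g / f and a = 1, alarms before a small multiple of e^h are rare, whence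
      h <= log gamma + O(1) (log_false_alarm_ge). Under g, with
      phi = e^(th min(l, c)) and a close to e^(th I), alarms before (1 - eps) h / I
      are rare (alarm_early_changed); the part of l above c is left to Markov's
      inequality. If the corrupt sensors copy an honest one, there is no other
      source of alarms, and the delay is at least (1 - eps) h / I
      (worst_delay_ge).

    - If phi is bounded with mean at least 1 + kappa, then the mean time to cross b
      is O(b) (sum_survival_le). With phi = e^((1 + th) min(l, c)) under f, the
      mean time to a false alarm is O(e^((1 + th) h)), whence
      log gamma <= (1 + th) h + O(1) (false_alarm_le).

    - Given any event of the past at the change time nu, a changed sensor is still
      silent at nu + j with conditional probability at most e^(th h) r^j, where
      r = e^(- th (I - delta)), by Markov's inequality for the product of the
      e^(- th l) after nu (window_probability_le). Since B has at least L sensors,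
      the conditional mean delay is at most h / (I - delta) + O(1), uniformly over
      nu, the past and the strategy (worst_delay_le).

    Only the first moment of l under g is assumed. Truncation at c controls the
    large values of l. Its negative values are harmless because e^(- l) has mean
    at most 1 under g, which bounds the quadratic error of the expansions in th
    (expR_scaled_le_neg). *)

Set Implicit Arguments.
Unset Strict Implicit.
Unset Printing Implicit Defensive.

Local Open Scope classical_set_scope.
Local Open Scope ring_scope.
Local Open Scope ereal_scope.

(** * Independence of the past and the future *)

Section sigma_of_theory.
Context {T : pointedType} {dE : measure_display} {E : measurableType dE}.
Context {I : Type} (D : set I) (Z : I -> T -> E).

Definition gen_of : set (set T) :=
  \bigcup_(i in D) preimage_set_system setT (Z i) measurable.

(** Measurability for the generated sigma-algebra, obtained by changing the
    source type, so that the closure properties of measurable functions apply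
    unchanged to functions of the past. *)
Definition adapted d' (T' : measurableType d') (W : T -> T') : Prop :=
  @measurable_fun _ _ (g_sigma_algebraType gen_of) _ setT W.

Lemma adapted_coord i : D i -> adapted (Z i).
Proof.
move=> Di _ B mB; apply: sub_sigma_algebra; exists i => //; exists B => //.
Qed.

Lemma adaptedP d' (T' : measurableType d') (W : T -> T') (B : set T') :
  adapted W -> measurable B -> sigma_of D Z (W @^-1` B).
Proof. by move=> aW mB; rewrite -[_ @^-1` _]setTI; exact: aW. Qed.

End sigma_of_theory.

Section sigma_of_measurable.
Context {d dE : measure_display} {T : measurableType d} {E : measurableType dE}.
Context {I : Type} (D : set I) (Z : I -> T -> E).
Hypothesis mZ : forall i, D i -> measurable_fun setT (Z i).

Lemma sigma_of_measurable (A : set T) : sigma_of D Z A -> measurable A.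
Proof.
apply: smallest_sub; first exact: sigma_algebra_measurable.
by move=> _ [i Di [B mB <-]]; exact: mZ.
Qed.

Lemma adapted_measurable d' (T' : measurableType d') (W : T -> T') :
  adapted D Z W -> measurable_fun setT W.
Proof. by move=> aW mT B mB; apply: sigma_of_measurable; exact: aW. Qed.

End sigma_of_measurable.

Lemma sub_adapted {T : pointedType} {dE} {E : measurableType dE} {I : Type}
    (D D' : set I) (Z : I -> T -> E) d' (T' : measurableType d') (W : T -> T') :
  D `<=` D' -> adapted D Z W -> adapted D' Z W.
Proof.
move=> DD' aW mT B mB; have := aW (@measurableT _ (g_sigma_algebraType (gen_of D Z))) B mB.
by apply: sub_sigma_algebra2 => U [i Di ZU]; exists i => //; exact: DD'.
Qed.

Section independence.
Context {R : realType} {d dE : measure_display}.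
Context {T : measurableType d} {E : measurableType dE}.
Context {I : eqType} (P : probability T R) (D D0 : set I) (Z : I -> T -> E).
Hypothesis mZ : forall i, D i -> measurable_fun setT (Z i).
Hypothesis indep : mutually_independent P D Z.
Hypothesis D0D : D0 `<=` D.

(** Both sides are finite measures in A, and they agree on the finite cylinders
    of coordinates in D0, which form a pi-system that generates the
    sigma-algebra of D0. *)
Lemma independent_coord (A : set T) i (C : set E) :
  sigma_of D0 Z A -> D i -> ~ D0 i -> measurable C ->
  P (A `&` Z i @^-1` C) = P A * P (Z i @^-1` C).
Proof.
move=> sA Di nDi mC.
pose cylinder (s : seq I) (A : I -> set E) : set T :=
  \bigcap_(i in [set` s]) (Z i @^-1` A i).
pose G := [set B | exists s A, [/\ uniq s, {subset s <= D0},
   (forall i, measurable (A i)) & B = cylinder s A]].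
have mcoord j B : D j -> measurable B -> measurable (Z j @^-1` B).
  by move=> Dj mB; rewrite -[_ @^-1` _]setTI; exact: mZ.
have mV : measurable (Z i @^-1` C) by exact: mcoord.
have mG : G `<=` measurable.
  move=> _ [s [B [us sD mB ->]]].
  elim: s us sD => [|j s IH] /= us sD.
    by rewrite (_ : cylinder _ _ = setT)//; apply/seteqP; split.
  rewrite (_ : cylinder _ _ = Z j @^-1` B j `&` cylinder s B); last first.
    apply/seteqP; split => w /=.
      move=> h; split; first by apply: h; rewrite /= mem_head.
      by move=> k /= ks; apply: h; rewrite /= inE ks orbT.
    by move=> [h1 h2] k /=; rewrite inE => /predU1P[->//|]; exact: h2.
  apply: measurableI.
    by apply: mcoord => //; apply/D0D/set_mem/sD; rewrite mem_head.
  apply: IH; first by case/andP: us.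
  by move=> k ks; apply: sD; rewrite inE ks orbT.
have GI : setI_closed G.
  move=> _ _ [s1 [A1 [us1 sD1 mA1 ->]]] [s2 [A2 [us2 sD2 mA2 ->]]].
  exists (undup (s1 ++ s2)),
    (fun j => (if j \in s1 then A1 j else setT) `&` (if j \in s2 then A2 j else setT)).
  split; first exact: undup_uniq.
  - by move=> j; rewrite mem_undup mem_cat => /orP[/sD1|/sD2].
  - by move=> j; apply: measurableI; case: ifP.
  - apply/seteqP; split => w /=.
      move=> [h1 h2] j _; split => /=.
        by case: ifPn => // j1; exact: h1.
      by case: ifPn => // j2; exact: h2.
    move=> h; split => j /= js.
      have : [set` undup (s1 ++ s2)] j by rewrite /= mem_undup mem_cat js.
      by move=> /h[] /=; rewrite js.
    have : [set` undup (s1 ++ s2)] j by rewrite /= mem_undup mem_cat js orbT.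
    by move=> /h[] /= _; rewrite js.
have {sA}sA : <<s G >> A.
  apply: (smallest_sub _ _ sA) => //.
  move=> _ [j D0j [B mB <-]].
  apply: sub_sigma_algebra; exists [:: j], (fun=> B); split => //.
    by move=> k; rewrite inE => /eqP ->; exact: mem_set.
  rewrite setTI; apply/seteqP; split => w /=.
    by move=> h k /=; rewrite inE => /eqP ->.
  by apply => /=; rewrite inE.
have PV0 : (0 <= fine (P (Z i @^-1` C)))%R by exact: fine_ge0.
have PVE : P (Z i @^-1` C) = (fine (P (Z i @^-1` C)))%:E.
  by rewrite fineK// fin_num_measure.
have GT : G setT.
  exists [::], (fun=> setT); split => //.
  by apply/seteqP; split => // w _ j.
suff : mrestr P mV A = mscale (NngNum PV0) P A.
  by rewrite /mrestr /mscale/= -PVE muleC.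
apply: (g_sigma_algebra_measure_unique G mG (fun=> setT)) => //.
- by apply/seteqP; split => // w _; exists 0%N.
- move=> _ [s [B [us sD mB ->]]].
  rewrite /= /mrestr /mscale/= -PVE.
  pose B' j := if j == i then C else B j.
  have is' : i \notin s by apply/negP => /sD/set_mem.
  have -> : cylinder s B = cylinder s B'.
    apply/seteqP; split => w h j /= js; have := h j js => /=; rewrite /B';
    by case: eqP => // ji; rewrite -ji js in is'.
  have -> : cylinder s B' `&` Z i @^-1` C = cylinder (i :: s) B'.
    apply/seteqP; split => w /=.
      move=> [h1 h2] j /=; rewrite inE => /predU1P[->|]; last exact: h1.
      by rewrite /B' eqxx.
    move=> h; split.
      by move=> j /= js; apply: h => /=; rewrite inE js orbT.
    by have := h i; rewrite /= /B' eqxx mem_head; exact.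
  have mB' j : measurable (B' j) by rewrite /B'; case: eqP.
  rewrite /cylinder indep//=; last 2 first.
  - by rewrite is' us.
  - move=> j; rewrite inE => /predU1P[->|/sD/set_mem/D0D]; exact: mem_set.
  rewrite big_cons indep//; first by rewrite /B' eqxx.
  by move=> j /sD/set_mem/D0D; exact: mem_set.
- by move=> k; rewrite /= /mrestr setTI; rewrite (le_lt_trans (probability_le1 _ _)) ?ltry.
Qed.

End independence.

Section integrals_of_random_variables.
Context {R : realType} {d : measure_display} {T : measurableType d}.
Variable P : probability T R.

(** The joint law of W and V is a product measure, so that Tonelli's theorem
    applies. *)
Lemma integral_mul_independent (W V : T -> \bar R) :
  measurable_fun setT W -> measurable_fun setT V ->
  (forall w, 0 <= W w) -> (forall w, 0 <= V w) ->
  (forall A B, measurable A -> measurable B ->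
     P (W @^-1` A `&` V @^-1` B) = P (W @^-1` A) * P (V @^-1` B)) ->
  \int[P]_w (W w * V w) = \int[P]_w W w * \int[P]_w V w.
Proof.
move=> mW mV W0 V0 WV.
pose W' : {RV P >-> \bar R} := HB.pack W (isMeasurableFun.Build _ _ _ _ W mW).
pose V' : {RV P >-> \bar R} := HB.pack V (isMeasurableFun.Build _ _ _ _ V mV).
pose WV' : T -> (\bar R * \bar R)%type := fun w => (W w, V w).
have mWV : measurable_fun setT WV' by exact: measurable_fun_pair.
pose U : {RV P >-> (\bar R * \bar R)%type} :=
  HB.pack WV' (isMeasurableFun.Build _ _ _ _ WV' mWV).
(* Absolute values make the product nonnegative on the whole plane, while
   changing nothing on the range of (W, V). *)
pose abs2 (z : \bar R * \bar R) := `|z.1| * `|z.2|.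
have mabs2 : measurable_fun setT abs2.
  by apply: emeasurable_funM; apply: measurableT_comp => //; exact: abse_measurable.
have abs20 z : 0 <= abs2 z by rewrite mule_ge0.
have -> : \int[P]_w (W w * V w) = \int[distribution P U]_z abs2 z.
  rewrite ge0_integral_distribution//; apply: eq_integral => w _ /=.
  by rewrite /abs2/= !gee0_abs.
rewrite (@eq_measure_integral _ _ _ _ (distribution P W' \x distribution P V')).
  rewrite fubini_tonelli1//.
  rewrite /fubini_F/= /abs2/=.
  have mabs : measurable_fun [set: \bar R] (@abse R) by exact: abse_measurable.
  under eq_integral do rewrite ge0_integralZl//.
  rewrite ge0_integralZr//; last exact: integral_ge0.
  rewrite !ge0_integral_distribution//=.
  by congr (_ * _); apply: eq_integral => w _ /=; rewrite gee0_abs.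
by move=> A mA _; apply/esym/product_measure_unique => //.
Qed.

(** The law of W is dominated by lambda, and its Radon-Nikodym derivative
    equals f almost everywhere. *)
Lemma integral_density {dE} {E : measurableType dE}
    (lambda : {sigma_finite_measure set E -> \bar R}) (f : E -> R)
    (W : T -> E) (phi : E -> \bar R) :
  is_density lambda f -> measurable_fun setT W ->
  (forall A, measurable A -> P [set w | A (W w)] = \int[lambda]_(x in A) (f x)%:E) ->
  measurable_fun setT phi -> (forall x, 0 <= phi x) ->
  \int[P]_w phi (W w) = \int[lambda]_x (phi x * (f x)%:E).
Proof.
move=> [mf f0 f1] mW lawW mphi phi0.
pose W' : {RV P >-> E} := HB.pack W (isMeasurableFun.Build _ _ _ _ W mW).
pose nu := distribution P W'.
have mfE : measurable_fun setT (EFin \o f) by exact/measurable_EFinP.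
have if_ : lambda.-integrable setT (EFin \o f).
  apply/integrableP; split => //.
  under eq_integral do rewrite /= ger0_norm//.
  by rewrite f1 ltry.
have numu : nu `<< lambda.
  apply/null_content_dominatesP => A mA A0; rewrite /nu /= /distribution /pushforward/=.
  by rewrite (lawW _ mA) null_set_integral//; exact: measurable_funS mfE.
rewrite -(ge0_integral_distribution W' mphi phi0).
rewrite -(Radon_Nikodym_SigmaFinite.change_of_variables numu)//.
apply: ge0_ae_eq_integral => //.
- apply: emeasurable_funM => //.
  exact: measurable_int (Radon_Nikodym_SigmaFinite.f_integrable numu).
- exact: emeasurable_funM.
- by move=> x _; rewrite mule_ge0// Radon_Nikodym_SigmaFinite.f_ge0.
- by move=> x _; rewrite mule_ge0// lee_fin.
have : ae_eq lambda setT (Radon_Nikodym_SigmaFinite.f nu lambda) (EFin \o f).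
  apply: (integral_ae_eq (mu := lambda) measurableT _ mfE).
    exact: Radon_Nikodym_SigmaFinite.f_integrable numu.
  move=> A _ mA; rewrite -(Radon_Nikodym_SigmaFinite.f_integral numu)//.
  exact: lawW.
by apply: filterS => x h xT; rewrite h.
Qed.

End integrals_of_random_variables.

(** * Crossing times of multiplicative CUSUM statistics *)

Section multiplicative_cusum.
Context {R : realType} {dE : measure_display} {E : measurableType dE} {K : nat}.
Variable phi : E -> \bar R.
Hypothesis mphi : measurable_fun setT phi.
Hypothesis phi0 : forall x, 0 <= phi x.

(** With phi = g / f this is the exponential of the CUSUM statistic: the
    reflection at 0 becomes a maximum with 1. Other choices of phi give tilted
    and truncated versions. *)
Fixpoint mcusum (x : nat -> 'I_K -> E) (k : 'I_K) (t : nat) : \bar R :=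
  if t is s.+1 then maxe (mcusum x k s * phi (x t k)) 1 else 1.

Lemma mcusum_ge1 x k t : 1 <= mcusum x k t.
Proof. by case: t => //= t; rewrite le_max lexx orbT. Qed.

Lemma mcusum_ge0 x k t : 0 <= mcusum x k t.
Proof. exact: le_trans (mcusum_ge1 x k t). Qed.

Definition crossed (b : R) k t : set (nat -> 'I_K -> E) :=
  [set x | exists2 s, (0 < s <= t)%N & b%:E <= mcusum x k s].

Lemma crossedS b k t x :
  crossed b k t.+1 x <-> crossed b k t x \/ b%:E <= mcusum x k t.+1.
Proof.
split=> [[s /andP[s0]]|[[s /andP[s0 st]]|]].
- rewrite leq_eqVlt => /predU1P[->|]; first by right.
  by rewrite ltnS => st bs; left; exists s => //; rewrite s0.
- by move=> bs; exists s => //; rewrite s0 ltnW.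
- by move=> bs; exists t.+1 => //=; rewrite leqnn.
Qed.

Lemma not_crossed0 b k x : ~ crossed b k 0 x.
Proof. by move=> [s]; case: s. Qed.

Lemma mcusum_le_not_crossed b k t x :
  (1 <= b)%R -> ~ crossed b k t x -> mcusum x k t <= b%:E.
Proof.
move=> b1; case: t => [_|t nc] /=; first by rewrite lee_fin.
by rewrite leNgt; apply/negP => /ltW h; apply: nc; exists t.+1; rewrite ?leqnn.
Qed.

Context {d : measure_display} {T : measurableType d}.
Variables (X : T -> nat -> 'I_K -> E) (k : 'I_K) (t : nat).
Hypothesis mX : forall s, (0 < s <= t)%N -> measurable_fun setT (fun w => X w s k).

Lemma measurable_mcusum s : (s <= t)%N ->
  measurable_fun setT (fun w => mcusum (X w) k s).
Proof.
elim: s => [|s IH] st; first exact: measurable_cst.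
apply: measurable_maxe => //; apply: emeasurable_funM; first exact/IH/ltnW.
by apply: measurableT_comp => //; exact: mX.
Qed.

Lemma measurable_crossed b : measurable [set w | crossed b k t (X w)].
Proof.
rewrite (_ : mkset _ = \bigcup_(s in [set s | (0 < s <= t)%N])
    [set w | b%:E <= mcusum (X w) k s]); last first.
  by apply/seteqP; split => w [s]; exists s.
apply: bigcup_measurable => s /= /andP[_ st].
rewrite -[mkset _]setTI; apply: emeasurable_fun_c_infty => //.
exact: measurable_mcusum.
Qed.

End multiplicative_cusum.

Section honest_process.
Context {R : realType} {d dE : measure_display}.
Context {T : measurableType d} {E : measurableType dE} {K : nat}.
Variables (N : {set 'I_K}) (X : T -> nat -> 'I_K -> E) (P : probability T R).
Hypothesis mX : forall t k, (0 < t)%N -> k \in N ->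
  measurable_fun setT (fun w => X w t k).
Hypothesis indX :
  mutually_independent P [set i : nat * 'I_K | (0 < i.1)%N && (i.2 \in N)]
    (fun i w => X w i.1 i.2).

Definition past (t : nat) : set (nat * 'I_K) :=
  [set i | (0 < i.1 <= t)%N && (i.2 \in N)].

Definition past_adapted d' (T' : measurableType d') (t : nat) (W : T -> T') :=
  adapted (past t) (fun i w => X w i.1 i.2) W.

Lemma past_adapted_measurable d' (T' : measurableType d') t (W : T -> T') :
  past_adapted t W -> measurable_fun setT W.
Proof.
by apply: adapted_measurable => -[s k] /= /andP[/andP[s0 _] kN]; exact: mX.
Qed.

Lemma past_adapted_coord s t k : (0 < s <= t)%N -> k \in N ->
  past_adapted t (fun w => X w s k).
Proof.
by move=> st kN; apply: (adapted_coord (i := (s, k))); rewrite /past/= st.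
Qed.

Lemma past_adapted_indic t (A : set T) :
  sigma_of (past t) (fun i w => X w i.1 i.2) A ->
  past_adapted t (fun w => (\1_A w)%:E : \bar R).
Proof.
move=> sA.
apply/measurable_EFinP.
exact: (measurable_indic (T := g_sigma_algebraType (gen_of (past t) (fun i w => X w i.1 i.2)))).
Qed.

(** The past up to time t is independent of a later observation. This is the
    only form in which independence over time is used below. *)
Lemma integral_past_mul t s k (W : T -> \bar R) (phi : E -> \bar R) :
  past_adapted t W -> (forall w, 0 <= W w) -> (t < s)%N -> k \in N ->
  measurable_fun setT phi -> (forall x, 0 <= phi x) ->
  \int[P]_w (W w * phi (X w s k)) =
  \int[P]_w W w * \int[P]_w phi (X w s k).
Proof.
move=> aW W0 ts kN mphi phi0.
have s0 : (0 < s)%N by exact: leq_ltn_trans ts.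
apply: integral_mul_independent => //.
- exact: past_adapted_measurable aW.
- by apply: measurableT_comp => //; exact: mX.
move=> A B mA mB.
have mB' : measurable (phi @^-1` B) by rewrite -[_ @^-1` _]setTI; exact: mphi.
apply: (@independent_coord _ _ _ _ _ _ P _ (past t) _ _ indX _ _ (s, k) _ _ _ _ mB').
- by move=> [u j] /= /andP[u0 jN]; exact: mX.
- by move=> [u j] /= /andP[/andP[u0 _] jN]; rewrite /= u0.
- exact: adaptedP aW mA.
- by rewrite /= s0.
- by move=> /= /andP[/andP[_]]; rewrite leqNgt ts.
Qed.

Section crossing.
Variables (phi : E -> \bar R) (k : 'I_K) (b : R).
Hypothesis mphi : measurable_fun setT phi.
Hypothesis phi0 : forall x, 0 <= phi x.
Hypothesis kN : k \in N.
Hypothesis b1 : (1 <= b)%R.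

Let z t w := mcusum phi (X w) k t.
Let C t := [set w | crossed phi b k t (X w)].
Let C' t := ~` C t.

Let killed t w := z t w * (\1_(C' t) w)%:E.

Let mC t : measurable (C t).
Proof.
by apply: measurable_crossed => // s /andP[s0 _]; exact: mX.
Qed.

Let sC' t : sigma_of (past t) (fun i w => X w i.1 i.2) (C' t).
Proof.
apply: (@measurableC _ (g_sigma_algebraType (gen_of (past t) (fun i w => X w i.1 i.2)))).
by apply: measurable_crossed => // s st; exact: past_adapted_coord.
Qed.

Let az t : past_adapted t (z t).
Proof.
by apply: (measurable_mcusum _ (t := t)) => // s st; exact: past_adapted_coord.
Qed.

Let akilled t : past_adapted t (killed t).
Proof. by apply: emeasurable_funM; [exact: az|exact: past_adapted_indic (@sC' t)]. Qed.

Let mkilled t : measurable_fun setT (killed t).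
Proof. exact: past_adapted_measurable (@akilled t). Qed.

Let killed_ge0 t w : 0 <= killed t w.
Proof. by rewrite mule_ge0 ?mcusum_ge0// lee_fin. Qed.

Let killed_step t : \int[P]_w (killed t w * phi (X w t.+1 k)) =
  \int[P]_w killed t w * \int[P]_w phi (X w t.+1 k).
Proof. by apply: integral_past_mul => //; exact: akilled. Qed.

Let mkilledphi t : measurable_fun setT (fun w => killed t w * phi (X w t.+1 k)).
Proof.
by apply: emeasurable_funM => //; apply: measurableT_comp => //; exact: mX.
Qed.

Let mindC (c : R) t : measurable_fun setT (fun w => c%:E * (\1_(C t) w)%:E).
Proof. by apply: measurable_funeM; exact/measurable_EFinP. Qed.

Let int_indC (c : R) t : (0 <= c)%R ->
  \int[P]_w (c%:E * (\1_(C t) w)%:E) = c%:E * P (C t).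
Proof.
move=> c0; rewrite ge0_integralZl//.
- by rewrite integral_indic// setIT.
- exact/measurable_EFinP.
Qed.

Let indC_ge0 (c : R) t w : (0 <= c)%R -> 0 <= c%:E * (\1_(C t) w)%:E.
Proof. by move=> c0; apply: mule_ge0; rewrite lee_fin. Qed.

Let b0 : (0 <= b)%R. Proof. exact: le_trans b1. Qed.

(** The value of a path is its statistic as long as it has not crossed, and the
    constant c from then on. At the crossing, c = b bounds the statistic from
    below, whereas c = b * M bounds it from above when phi is at most M. *)
Let potential c t := \int[P]_w (killed t w + c%:E * (\1_(C t) w)%:E).

Let potentialE c t : (0 <= c)%R ->
  potential c t = \int[P]_w killed t w + c%:E * P (C t).
Proof.
move=> c0; rewrite /potential ge0_integralD//; first by rewrite int_indC.
by move=> w _; exact: indC_ge0.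
Qed.

Let inC t w : w \in C t -> w \in C t.+1.
Proof. by move=> /set_mem h; apply/mem_set/crossedS; left. Qed.

(** Before the crossing the statistic is multiplied by phi, whose mean is at
    most a, and the maximum with 1 adds at most 1. At the crossing it is at
    least b. Hence u t = potential b t satisfies u (t + 1) <= a * u t + 1, and
    b * P (C n) is at most u n. The linear factor n + 1, harmless against an
    exponential, is the price of the reflection. *)
Lemma crossing_probability_le (a : R) n : (1 <= a)%R ->
  (forall t, (0 < t <= n)%N -> \int[P]_w phi (X w t k) <= a%:E) ->
  P (C n) <= (n.+1%:R * a ^+ n / b)%:E.
Proof.
move=> a1 phia.
have a0 : (0 <= a)%R by exact: le_trans a1.
have step t : (t < n)%N -> potential b t.+1 <= a%:E * potential b t + 1.
  move=> tn.
  have : potential b t.+1 <=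
      \int[P]_w (b%:E * (\1_(C t) w)%:E + (killed t w * phi (X w t.+1 k) + 1)).
    apply: ge0_le_integral => //.
    - by move=> w _; rewrite adde_ge0// indC_ge0.
    - by apply: emeasurable_funD.
    - by apply: emeasurable_funD => //; apply: emeasurable_funD.
    move=> w _; rewrite /killed !indicE !in_setC.
    have [/[dup] Ct /inC -> |Ct] /= := boolP (w \in C t).
      by rewrite !mule0 !mule1 mul0e !add0e leeDl.
    have zS : z t.+1 w <= z t w * phi (X w t.+1 k) + 1.
      by rewrite /z/= ge_max leeDl//= leeDr// mule_ge0// mcusum_ge0.
    rewrite !mule0 !mule1 add0e.
    have [|Ct1] /= := boolP (w \in C t.+1); last by rewrite mule1 mule0 adde0.
    move=> /set_mem/crossedS[Cw|bz]; first by case/negP: Ct; exact: mem_set.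
    by rewrite mule0 mule1 add0e (le_trans bz).
  move=> /le_trans; apply.
  rewrite ge0_integralD//; last 3 first.
  - by move=> w _; exact: indC_ge0.
  - by move=> w _; apply: adde_ge0 => //; exact: mule_ge0.
  - by apply: emeasurable_funD.
  rewrite int_indC// ge0_integralD//; last by move=> w _; exact: mule_ge0.
  rewrite integral_cst//= probability_setT mule1 killed_step.
  rewrite addeA leeD2r// potentialE// addeC.
  have k0 : 0 <= \int[P]_w killed t w by exact: integral_ge0.
  have c0 : 0 <= b%:E * P (C t) by exact: mule_ge0.
  rewrite [leRHS](ge0_muleDr _ k0 c0).
  apply: leeD.
    by rewrite muleC lee_wpmul2r ?integral_ge0//; exact: phia.
  by rewrite lee_pemull// lee_fin.
have bound t : (t <= n)%N -> potential b t <= (t.+1%:R * a ^+ t)%:E.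
  elim: t => [_|t IH tn].
    rewrite potentialE// (_ : C 0 = set0); last first.
      by apply/seteqP; split => // w; exact: not_crossed0.
    rewrite measure0 mule0 adde0 expr0 mulr1.
    apply: (@le_trans _ _ (\int[P]_w 1)); last first.
      by rewrite integral_cst//= probability_setT mule1.
    apply: ge0_le_integral => // w _.
    by rewrite /killed/= mul1e lee_fin indicE; case: (_ \in _).
  apply: (le_trans (step _ tn)).
  apply: (@le_trans _ _ (a%:E * (t.+1%:R * a ^+ t)%:E + 1)).
    rewrite leeD2r// lee_wpmul2l//; apply: IH; exact: ltnW.
  rewrite -EFinM -EFinD lee_fin exprS.
  have : (1 <= a * a ^+ t)%R by rewrite -exprS exprn_ege1.
  rewrite (_ : t.+2%:R = t.+1%:R + 1 :> R)%R ?natr1//.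
  set u := (t.+1%:R)%R; set v := (a ^+ t)%R; nra.
have bp : (0 < b)%R by exact: lt_le_trans b1.
rewrite EFinM lee_pdivlMr// muleC (le_trans _ (bound n _))// potentialE//.
by rewrite leeDr// integral_ge0.
Qed.

(** While the path survives its statistic is at least 1, and grows in mean by
    at least kappa times itself; at the crossing it is at most b * M. So
    potential (b * M), which never exceeds b * M, increases in each step by at
    least kappa times the survival probability. The sum of these probabilities
    is the mean crossing time. *)
Lemma sum_survival_le (M kappa : R) n : (1 <= M)%R -> (0 <= kappa)%R ->
  (forall x, phi x <= M%:E) ->
  (forall t, (0 < t)%N -> (1 + kappa)%:E <= \int[P]_w phi (X w t k)) ->
  kappa%:E * \sum_(0 <= t < n) P (~` [set w | crossed phi b k t (X w)]) <=
  (b * M)%:E.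
Proof.
move=> M1 kappa0 phiM phik.
have c0 : (0 <= b * M)%R by rewrite mulr_ge0// (le_trans _ M1).
have bM : (b <= b * M)%R by rewrite ler_peMr.
have survive t w : w \notin C t -> z t w <= b%:E.
  by move=> /negP nC; apply: mcusum_le_not_crossed => // Cw; apply: nC; exact: mem_set.
have step t : potential (b * M) t + kappa%:E * P (C' t) <= potential (b * M) t.+1.
  have : \int[P]_w (killed t w * phi (X w t.+1 k) + (b * M)%:E * (\1_(C t) w)%:E) <=
      potential (b * M) t.+1.
    apply: ge0_le_integral => //.
    - by move=> w _; apply: adde_ge0; [exact: mule_ge0|exact: indC_ge0].
    - by apply: emeasurable_funD.
    - by apply: emeasurable_funD.
    move=> w _; rewrite /killed !indicE !in_setC.
    have [/inC -> |Ct] /= := boolP (w \in C t).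
      by rewrite !mule0 !mule1 mul0e !add0e.
    rewrite !mule0 !mule1 adde0.
    have [Ct1|Ct1] /= := boolP (w \in C t.+1).
      rewrite mule0 mule1 add0e EFinM; apply: lee_pmul => //.
      - exact: mcusum_ge0.
      - exact: survive.
    by rewrite mule1 mule0 adde0 /z/= le_max lexx.
  apply: le_trans.
  rewrite ge0_integralD//; last 2 first.
  - by move=> w _; exact: mule_ge0.
  - by move=> w _; exact: indC_ge0.
  rewrite int_indC// killed_step potentialE// addeAC leeD2r//.
  have k0 : 0 <= \int[P]_w killed t w by exact: integral_ge0.
  apply: (@le_trans _ _ (\int[P]_w killed t w * (1 + kappa)%:E)); last first.
    by rewrite lee_wpmul2l// phik.
  rewrite EFinD ge0_muleDr// mule1 leeD2l// muleC lee_wpmul2r//.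
  rewrite -(setIT (C' t)) -integral_indic//; last exact: measurableC.
  apply: ge0_le_integral => //.
    exact/measurable_EFinP/measurable_indic/measurableC.
  by move=> w _; rewrite /killed lee_pemull// mcusum_ge1.
have telescope m : kappa%:E * \sum_(0 <= t < m) P (C' t) <= potential (b * M) m.
  elim: m => [|m IH].
    by rewrite big_nil mule0 potentialE// adde_ge0 ?integral_ge0// mule_ge0.
  rewrite big_nat_recr//= ge0_muleDr//; last by apply: sume_ge0.
  by apply: le_trans (step m); rewrite leeD2r.
apply: (le_trans (telescope n)).
apply: (@le_trans _ _ (\int[P]_w (b * M)%:E)); last first.
  by rewrite integral_cst//= probability_setT mule1.
apply: ge0_le_integral => //.
- by move=> w _; apply: adde_ge0 => //; exact: indC_ge0.
- by apply: emeasurable_funD.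
move=> w _; rewrite /killed !indicE !in_setC.
have [Cn|Cn] /= := boolP (w \in C n); first by rewrite mule0 mule1 add0e.
by rewrite mule1 mule0 adde0 (le_trans (survive _ _ Cn))// lee_fin.
Qed.

End crossing.

Fixpoint window (phi : E -> \bar R) (x : nat -> 'I_K -> E) k nu j : \bar R :=
  if j is i.+1 then window phi x k nu i * phi (x (nu + j)%N k) else 1.

(** Markov's inequality for the product of phi over the j observations after
    nu, conditionally on an event A of the past at nu. The bound does not
    depend on A otherwise than by its probability, as a worst case over the
    past requires. *)
Lemma window_probability_le (phi : E -> \bar R) k nu j (A S : set T) (c rho : R) :
  measurable_fun setT phi -> (forall x, 0 <= phi x) -> k \in N ->
  (0 <= c)%R -> (0 <= rho)%R ->
  sigma_of (past nu) (fun i w => X w i.1 i.2) A -> measurable S ->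
  (forall t, (nu < t)%N -> \int[P]_w phi (X w t k) <= rho%:E) ->
  (forall w, S w -> 1 <= c%:E * window phi (X w) k nu j) ->
  P (A `&` S) <= (c * rho ^+ j)%:E * P A.
Proof.
move=> mphi phi0 kN c0 rho0 sA mS phirho Sc.
have mA : measurable A.
  apply: sigma_of_measurable sA => -[s i] /= /andP[/andP[s0 _] iN]; exact: mX.
pose W i w := (\1_A w)%:E * window phi (X w) k nu i.
have aW i : past_adapted (nu + i) (W i).
  have pastS a b : (a <= b)%N -> past a `<=` past b.
    move=> ab [s l] /= /andP[/andP[s0 sa] lN].
    by rewrite /past/= s0 (leq_trans sa ab).
  apply: emeasurable_funM.
    apply: (sub_adapted (D := past nu)); first exact/pastS/leq_addr.
    exact: past_adapted_indic.
  elim: i => [|i IH] /=; first exact: measurable_cst.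
  apply: emeasurable_funM.
    by apply: (sub_adapted (D := past (nu + i))) IH; apply: pastS; rewrite addnS.
  apply: measurableT_comp => //; apply: past_adapted_coord => //.
  by rewrite addnS leqnn.
have W0 i w : 0 <= W i w.
  rewrite /W mule_ge0//.
  by elim: i => //= i IH; rewrite mule_ge0.
have mW i : measurable_fun setT (W i) by exact: past_adapted_measurable (aW i).
have intW i : \int[P]_w W i w <= (rho ^+ i)%:E * P A.
  elim: i => [|i IH].
    rewrite expr0 mul1e -(setIT A) -integral_indic// le_eqVlt.
    apply/orP; left; apply/eqP; apply: eq_integral => w _.
    by rewrite /W/= mule1.
  have -> : \int[P]_w W i.+1 w = \int[P]_w (W i w * phi (X w (nu + i.+1)%N k)).
    by apply: eq_integral => w _; rewrite /W/= muleA.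
  rewrite (integral_past_mul (aW i))//; last by rewrite addnS.
  rewrite exprSr EFinM muleAC; apply: lee_pmul => //.
  - exact: integral_ge0.
  - exact: integral_ge0.
  - by apply: phirho; rewrite addnS ltnS leq_addr.
rewrite EFinM -muleA.
apply: (@le_trans _ _ (c%:E * \int[P]_w W j w)); last by rewrite lee_wpmul2l.
rewrite -ge0_integralZl// -(setIT (A `&` S)) -integral_indic//; last exact: measurableI.
apply: ge0_le_integral => //.
- exact/measurable_EFinP/measurable_indic/measurableI.
- exact: measurable_funeM.
move=> w _; rewrite indicE; have [|_] := boolP (w \in A `&` S); last exact: mule_ge0.
move=> /set_mem[Aw Sw]; rewrite /W indicE mem_set// mul1e; exact: Sc.
Qed.

End honest_process.

(** * Exponential inequalities *)

Section exponential_inequalities.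
Context {R : realType}.
Local Open Scope ring_scope.

(** Multiply e^u - 1 <= u e^u by u if u is nonnegative, and u <= e^u - 1 by u
    if it is negative, to bound u (e^u - 1) by the quadratic term; the first
    inequality also gives e^u - 1 - u <= u (e^u - 1). *)
Lemma expR_le_quadratic (u : R) : expR u <= 1 + u + u ^+ 2 * expR `|u|.
Proof.
have h1 : expR u - 1 <= u * expR u.
  have := expR_ge1Dx (- u); rewrite expRN => h.
  have e0 := expR_gt0 u.
  have : expR u * (1 - u) <= expR u * (expR u)^-1 by rewrite ler_wpM2l// ltW.
  by rewrite divff ?gt_eqF// mulrBr mulr1; lra.
have h2 := expR_ge1Dx u.
have [u0|u0] := leP 0 u.
  rewrite ger0_norm//.
  have : u * (expR u - 1) <= u * (u * expR u) by rewrite ler_wpM2l.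
  by rewrite expr2; lra.
have e1 : 1 <= expR `|u| by rewrite -expR0 ler_expR.
have e2 : 0 < expR u by exact: expR_gt0.
have : u * (expR u - 1) <= u ^+ 2 * expR `|u|.
  apply: (@le_trans _ _ (u ^+ 2 * 1)); last by rewrite ler_wpM2l// sqr_ge0.
  rewrite mulr1 expr2; nra.
lra.
Qed.

(** If u is the logarithm of a likelihood ratio g / f, the mean of e^{-u} under
    g is at most 1; this bounds the quadratic error below without any second
    moment. The constant comes from u^2 <= 16 e^{|u| / 2}, the other half of
    the exponent absorbing e^{|th u|}. *)
Lemma expR_scaled_le_neg (th u : R) : `|th| <= 2^-1 -> u <= 0 ->
  expR (th * u) <= 1 + th * u + th ^+ 2 * (16 * expR (- u)).
Proof.
move=> th1 u0; apply: (le_trans (expR_le_quadratic _)); rewrite lerD2l.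
rewrite exprMn -mulrA ler_wpM2l ?sqr_ge0//.
have v0 : 0 <= - u / 4 by lra.
have vE : expR (- u) = expR (- u / 4) ^+ 4.
  by rewrite -expRM_natl; congr expR; lra.
have w1 := expR_ge1Dx (- u / 4).
have : expR `|th * u| <= expR (- u / 4) ^+ 2.
  rewrite -expRM_natl ler_expR normrM (ler0_norm u0).
  have : `|th| * - u <= 2^-1 * - u by rewrite ler_wpM2r// oppr_ge0.
  lra.
have e0 : 0 <= expR `|th * u| by exact: expR_ge0.
rewrite vE; set y := expR (- u / 4) in w1 *; set z := expR `|th * u| in e0 * => zy.
have -> : u ^+ 2 = 16 * (- u / 4) ^+ 2 by field.
rewrite -mulrA ler_wpM2l// (_ : y ^+ 4 = y ^+ 2 * y ^+ 2); last by rewrite -exprD.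
apply: ler_pM => //; first by rewrite sqr_ge0.
by rewrite ler_sqr ?nnegrE//; lra.
Qed.

(** Above, the logarithm of the likelihood ratio has only a first moment and
    has to be truncated at some c, at the cost of an error term that depends on
    c but is still quadratic in th. *)
Lemma expR_scaled_le_pos (th u c : R) : `|th| <= 2^-1 -> 0 <= u <= c ->
  expR (th * u) <= 1 + th * u + th ^+ 2 * (c ^+ 2 * expR c).
Proof.
move=> th1 /andP[u0 uc]; apply: (le_trans (expR_le_quadratic _)); rewrite lerD2l.
rewrite exprMn -mulrA ler_wpM2l ?sqr_ge0//.
apply: ler_pM; rewrite ?sqr_ge0 ?expR_ge0//.
  by rewrite ler_sqr ?nnegrE// (le_trans u0).
rewrite ler_expR normrM (ger0_norm u0) (le_trans _ uc)//.
by rewrite ler_piMl// (le_trans th1)//; lra.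
Qed.

(** For h >= 1 the left-hand side is at most (A + 1) h, and e^{b h} is at least
    (b h / 2)^2. *)
Lemma affine_le_exp (A b z : R) : 0 <= A -> 0 < b -> 0 < z ->
  exists2 H, 1 <= H & forall h, H <= h -> A * h + 1 <= z * expR (b * h).
Proof.
move=> A0 b0 z0; exists (Num.max 1 (4 * (A + 1) / (b ^+ 2 * z))).
  by rewrite le_max lexx.
move=> h; rewrite ge_max => /andP[h1 hH].
have h0 : (0 < h) by lra.
have e2 : (expR (b * h) = expR (b * h / 2) ^+ 2).
  by rewrite -expRM_natl; congr expR; field.
have e1 := expR_ge1Dx (b * h / 2).
have bh0 : (0 < b * h) by exact: mulr_gt0.
have e3 : ((b * h / 2) ^+ 2 <= expR (b * h)).
  by rewrite e2 ler_sqr ?nnegrE ?expR_ge0//; lra.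
have hz : (4 * (A + 1) <= h * (b ^+ 2 * z)).
  by rewrite -ler_pdivrMr// mulr_gt0// exprn_gt0.
apply: (@le_trans _ _ ((A + 1) * h)); first lra.
apply: (@le_trans _ _ (z * (b * h / 2) ^+ 2)); last by rewrite ler_wpM2l// ltW.
have -> : (z * (b * h / 2) ^+ 2 = (h * (b ^+ 2 * z)) / 4 * h) by field.
rewrite ler_wpM2r// ?(ltW h0)//; lra.
Qed.

End exponential_inequalities.

(** * Relative entropy and tilted likelihood ratios *)

Section relative_entropy.
Context {R : realType} {dE : measure_display} {E : measurableType dE}.
Variables (lambda : {sigma_finite_measure set E -> \bar R}) (f g : E -> R).
Hypothesis df : is_density lambda f.
Hypothesis dg : is_density lambda g.

Let mf : measurable_fun setT f. Proof. by case: df. Qed.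
Let mg : measurable_fun setT g. Proof. by case: dg. Qed.
Let f0 x : (0 <= f x)%R. Proof. by case: df. Qed.
Let g0 x : (0 <= g x)%R. Proof. by case: dg. Qed.
Let int_f : \int[lambda]_x (f x)%:E = 1. Proof. by case: df. Qed.
Let int_g : \int[lambda]_x (g x)%:E = 1. Proof. by case: dg. Qed.

Definition lr (x : E) : R := ln (g x / f x).

Lemma llrE x : llr f g x =
  if g x == 0%R then -oo else if f x == 0%R then +oo else (lr x)%:E.
Proof.
rewrite /llr /lr; have [->|gx] := eqVneq (g x) 0%R; first by rewrite mul0e /= lexx.
have gx0 : (0 < g x)%R by rewrite lt_neqAle eq_sym gx g0.
have [->|fx] := eqVneq (f x) 0%R.
  by rewrite /inve eqxx gt0_muley// lte_fin.
have fx0 : (0 < f x)%R by rewrite lt_neqAle eq_sym fx f0.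
by rewrite /inve (negbTE fx) -EFinM lne_EFin// divr_gt0.
Qed.

Definition supp : set E := [set x | (0 < f x)%R /\ (0 < g x)%R].

Lemma llr_supp x : supp x -> llr f g x = (lr x)%:E.
Proof. by move=> [f1 g1]; rewrite llrE !gt_eqF. Qed.

Lemma not_supp x : ~ supp x -> g x = 0%R \/ f x = 0%R /\ (0 < g x)%R.
Proof.
rewrite /supp/= => h; have := f0 x; have := g0 x.
rewrite !le_eqVlt => /predU1P[<-|gx]; first by left.
by move=> /predU1P[<-|fx]; [right|case: h].
Qed.

Lemma measurable_lr : measurable_fun setT lr.
Proof.
apply: (measurableT_comp (@measurable_ln R)); apply: measurable_funM => //.
rewrite (_ : (fun x => (f x)^-1) = (fun x => f x `^ (-1)))%R; last first.
  by apply/funext => x; rewrite powR_inv1.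
exact: (measurableT_comp (measurable_powR (-1)%R) mf).
Qed.

Lemma measurable_llr : measurable_fun setT (llr f g).
Proof.
rewrite (_ : llr f g = fun x => if g x == 0%R then -oo else
    if f x == 0%R then +oo else (lr x)%:E); last by apply/funext => x; exact: llrE.
apply: measurable_fun_ifT => //; first exact: measurable_fun_eqr.
apply: measurable_fun_ifT => //; first exact: measurable_fun_eqr.
apply/measurable_EFinP; exact: measurable_lr.
Qed.

Hypothesis KLy : KL lambda f g < +oo.

Let ln_le (u : R) : (0 < u)%R -> (ln u <= u - 1)%R.
Proof. by move=> u0; have := @le_ln1Dx R (u - 1)%R; rewrite addrCA subrr addr0; apply; lra. Qed.

(** The negative part needs no assumption: since ln u <= u - 1, it is dominated
    by f. The positive part is then integrable because the relative entropy is
    finite. *)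
Lemma llr_weighted_integrable :
  lambda.-integrable setT (fun x => llr f g x * (g x)%:E).
Proof.
pose u x := llr f g x * (g x)%:E; rewrite -/u.
have mu : measurable_fun setT u.
  by apply: emeasurable_funM; [exact: measurable_llr|exact/measurable_EFinP].
have un x : (u^\- x <= (f x)%:E)%E.
  rewrite funenegE /u; have [sx|/not_supp[->|[fx gx]]] := pselect (supp x).
  - rewrite llr_supp// -EFinM -EFinN ge_max !lee_fin f0 andbT -mulNr.
    case: sx => fx gx.
    have -> : (- lr x = ln (f x / g x))%R.
      by rewrite /lr -lnV ?invf_div// posrE divr_gt0.
    have := ln_le (divr_gt0 fx gx).
    move=> /(ler_wpM2r (ltW gx)) /le_trans; apply.
    by rewrite mulrBl mul1r divfK ?gt_eqF// gerBl ltW.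
  - by rewrite mule0 oppe0 maxxx lee_fin f0.
  - by rewrite llrE gt_eqF// fx eqxx gt0_mulye ?lte_fin//= maxNye.
have intun : \int[lambda]_x u^\- x <= 1.
  rewrite -int_f; apply: ge0_le_integral => //; first exact: measurable_funeneg.
  exact/measurable_EFinP.
have intu : \int[lambda]_x u^\+ x < +oo.
  move: KLy; rewrite /KL -/u integralE !ltey; apply: contra => /eqP ->.
  rewrite addye// eqe_oppLR/=; apply: contraTneq intun => ->; by [].
apply/integrableP; split => //.
rewrite (_ : (fun x => `|u x|) = abse \o u)// fune_abse ge0_integralD//; last 2 first.
- exact: measurable_funepos.
- exact: measurable_funeneg.
by rewrite lte_add_pinfty// (le_lt_trans intun)// ltry.
Qed.

(** Where f vanishes and g does not, the logarithm is infinite, which its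
    integrability against g excludes almost everywhere. *)
Lemma ae_supp : {ae lambda, forall x, (0 < g x)%R -> (0 < f x)%R}.
Proof.
have := integrable_ae measurableT llr_weighted_integrable.
apply: filterS => x /(_ Logic.I) + gx; rewrite llrE gt_eqF//.
by have [->|fx _] := eqVneq (f x) 0%R; rewrite ?gt0_mulye ?lte_fin// lt_neqAle eq_sym fx f0.
Qed.

Let wlr x := (lr x * g x)%R.

Let mwlr : measurable_fun setT wlr.
Proof. by apply: measurable_funM => //; exact: measurable_lr. Qed.

Let int_f_fin : lambda.-integrable setT (EFin \o f).
Proof.
apply/integrableP; split; first exact/measurable_EFinP.
by under eq_integral do rewrite /= ger0_norm//; rewrite int_f ltry.
Qed.

Let int_g_fin : lambda.-integrable setT (EFin \o g).
Proof.
apply/integrableP; split; first exact/measurable_EFinP.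
by under eq_integral do rewrite /= ger0_norm//; rewrite int_g ltry.
Qed.

Let wlrE : {ae lambda, forall x, setT x -> llr f g x * (g x)%:E = (wlr x)%:E}.
Proof.
apply: filterS ae_supp => x gf _; have [sx|/not_supp[gx|[fx gx]]] := pselect (supp x).
- by rewrite llr_supp.
- by rewrite /wlr gx mule0 mulr0.
- by have := gf gx; rewrite fx ltxx.
Qed.

Let int_wlr_fin : lambda.-integrable setT (EFin \o wlr).
Proof.
apply: le_integrable llr_weighted_integrable => //; first exact/measurable_EFinP.
move=> x _; have [sx|/not_supp[gx|[fx gx]]] := pselect (supp x).
- by rewrite llr_supp// lexx.
- by rewrite /wlr /= gx mulr0 normr0 abse_ge0.
- by rewrite llrE gt_eqF// fx eqxx gt0_mulye ?lte_fin//= leey.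
Qed.

Let int_wlr : \int[lambda]_x (wlr x)%:E = KL lambda f g.
Proof.
apply: ae_eq_integral => //; first exact/measurable_EFinP.
  exact: measurable_int llr_weighted_integrable.
by apply: filterS wlrE => x h /h ->.
Qed.

Lemma KL_fin : KL lambda f g \is a fin_num.
Proof. by rewrite -int_wlr; exact: integrable_fin_num int_wlr_fin. Qed.

(** The part of the log-likelihood ratio that is lost by truncation at c. *)
Definition excess (c : R) x : R := (Num.max (lr x - c) 0 * g x)%R.

Let mexcess c : measurable_fun setT (excess c).
Proof.
apply: measurable_funM => //; apply: measurable_maxr => //.
by apply: measurable_funB => //; exact: measurable_lr.
Qed.

Let excess_le c x : (0 <= c)%R -> (`|excess c x| <= `|wlr x|)%R.
Proof.
move=> c0; rewrite /excess /wlr !normrM ler_wpM2r//.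
rewrite ger0_norm ?le_max ?lexx ?orbT// ge_max normr_ge0 andbT.
by rewrite (le_trans _ (ler_norm _))// gerBl.
Qed.

Let int_excess_fin c : (0 <= c)%R -> lambda.-integrable setT (EFin \o excess c).
Proof.
move=> c0; apply: le_integrable int_wlr_fin => //; first exact/measurable_EFinP.
by move=> x _; rewrite /= lee_fin excess_le.
Qed.

Definition mean_excess c : R := fine (\int[lambda]_x (excess c x)%:E).

Let int_excess c : (0 <= c)%R ->
  \int[lambda]_x (excess c x)%:E = (mean_excess c)%:E.
Proof. by move=> c0; rewrite fineK//; exact: integrable_fin_num (int_excess_fin c0). Qed.

(** Dominated convergence as c tends to infinity. Truncating the log-likelihood
    ratio thus changes its mean under g by as little as desired. *)
Lemma mean_excess_small (delta : R) : (0 < delta)%R ->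
  exists2 c, (0 <= c)%R & (0 <= mean_excess c <= delta)%R.
Proof.
move=> d0.
have dom := @dominated_convergence _ _ _ lambda
  setT measurableT (fun n x => (excess n%:R x)%:E) (cst 0)
  (fun x => `|(wlr x)%:E|) (fun n => (measurable_EFinP _ _).2 (@mexcess n%:R))
  (measurable_cst _) _ (integrable_abse int_wlr_fin).
have {dom}[||_ _] := dom.
- apply: aeW => x _; apply: cvg_near_cst; near=> n.
  rewrite /excess max_r ?mul0r// subr_le0.
  by near: n; exact: nbhs_infty_ger.
- by apply: aeW => x n _; rewrite /= lee_fin excess_le.
rewrite integral0 => /fine_cvgP[_ /cvgr_lt /(_ _ d0)][n _ /(_ n (leqnn n)) /= h].
exists n%:R => //; rewrite (ltW h) andbT.
apply/fine_ge0/integral_ge0 => x _; rewrite lee_fin /excess.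
by rewrite mulr_ge0// le_max lexx orbT.
Unshelve. all: by end_near. Qed.

Lemma measurable_expeR : measurable_fun [set: \bar R] (@expeR R).
Proof.
rewrite (_ : @expeR R = fun x => if x == +oo then +oo else if x == -oo then 0 else
    (expR (fine x))%:E); last by apply/funext => -[].
apply: measurable_fun_ifT => //; first exact: measurable_fun_eqe.
apply: measurable_fun_ifT => //; first exact: measurable_fun_eqe.
apply/measurable_EFinP; apply: (measurableT_comp (@measurable_expR R)).
exact: fine_measurable.
Qed.

Let I := fine (KL lambda f g).

(** All the integrands below are compared with such combinations, whose
    integrals are known. *)
Let comb (a b c e k : R) x := (a * f x + b * g x + c * wlr x + e * excess k x)%R.

Let mcomb a b c e k : measurable_fun setT (comb a b c e k).
Proof.
by do !(apply: measurable_funD => //; last exact: measurable_funM);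
   exact: measurable_funM.
Qed.

Let scaled_integrable (c : R) (u : E -> R) : lambda.-integrable setT (EFin \o u) ->
  lambda.-integrable setT (EFin \o (fun x => c * u x)%R).
Proof.
move=> iu; rewrite (_ : _ \o _ = fun x => c%:E * (EFin \o u) x); first exact: integrableZl.
by apply/funext => x.
Qed.

Let int_scaled (c : R) (u : E -> R) : lambda.-integrable setT (EFin \o u) ->
  \int[lambda]_x (c * u x)%:E = c%:E * \int[lambda]_x (u x)%:E.
Proof. by move=> iu; rewrite -integralZl//; apply: eq_integral => x _; rewrite EFinM. Qed.

Let sum_integrable (u v : E -> R) : lambda.-integrable setT (EFin \o u) ->
  lambda.-integrable setT (EFin \o v) ->
  lambda.-integrable setT (EFin \o (fun x => u x + v x)%R).
Proof.
move=> iu iv; rewrite (_ : _ \o _ = (EFin \o u) \+ (EFin \o v)); first exact: integrableD.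
by apply/funext => x.
Qed.

Let int_comb a b c e k : (0 <= k)%R ->
  \int[lambda]_x (comb a b c e k x)%:E = (a + b + c * I + e * mean_excess k)%:E.
Proof.
move=> k0; have ie := int_excess_fin k0.
have sE (u v : E -> R) : lambda.-integrable setT (EFin \o u) ->
    lambda.-integrable setT (EFin \o v) ->
    \int[lambda]_x (u x + v x)%:E = \int[lambda]_x (u x)%:E + \int[lambda]_x (v x)%:E.
  by move=> iu iv; rewrite -integralD_EFin.
rewrite /comb !sE; do ?[exact: scaled_integrable|apply: sum_integrable].
rewrite !int_scaled// int_f int_g int_wlr int_excess//.
by rewrite -(fineK KL_fin) !mule1.
Qed.

(** Where f vanishes, so does g almost everywhere; therefore the bound on the
    integrand has to be checked only where both are positive. *)
Let integral_g_le (phi : E -> \bar R) a b c e k :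
  measurable_fun setT phi -> (forall x, 0 <= phi x) ->
  (0 <= a)%R -> (0 <= b)%R -> (0 <= k)%R ->
  (forall x, supp x -> phi x * (g x)%:E <= (comb a b c e k x)%:E) ->
  \int[lambda]_x (phi x * (g x)%:E) <= (a + b + c * I + e * mean_excess k)%:E.
Proof.
move=> mphi phi0 a0 b0 k0 h; rewrite -int_comb//.
have gphi0 x : 0 <= phi x * (g x)%:E by rewrite mule_ge0// lee_fin.
apply: ae_ge0_le_integral => //.
- by apply: emeasurable_funM => //; exact/measurable_EFinP.
- move=> x _; have [/h|] := pselect (supp x); first exact: le_trans.
  rewrite /comb /wlr /excess /lr lee_fin => /not_supp[->|[-> gx]].
    by rewrite !mulr0 !addr0 mulr_ge0.
  rewrite invr0 !mulr0 ln0// sub0r max_r ?oppr_le0// !mul0r !mulr0 !addr0 add0r.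
  by rewrite mulr_ge0// ltW.
- exact/measurable_EFinP.
apply: filterS ae_supp => x gf _; have [/h//|/not_supp[gx|[fx gx]]] := pselect (supp x).
  by rewrite /comb /wlr /excess gx mule0 !mulr0 !addr0 lee_fin mulr_ge0.
by have := gf gx; rewrite fx ltxx.
Qed.

(** Change of measure: f times g / f is g, or 0 where f vanishes. *)
Lemma integral_likelihood_ratio_le : \int[lambda]_x (expeR (llr f g x) * (f x)%:E) <= 1.
Proof.
rewrite -int_g; apply: ge0_le_integral => //.
- by move=> x _; rewrite mule_ge0 ?expeR_ge0// lee_fin.
- apply: emeasurable_funM; last exact/measurable_EFinP.
  by apply: measurableT_comp; [exact: measurable_expeR|exact: measurable_llr].
- exact/measurable_EFinP.
move=> x _; have [sx|/not_supp[gx|[fx gx]]] := pselect (supp x).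
- rewrite llr_supp//; case: sx => fx gx.
  by rewrite /= /lr lnK ?posrE ?divr_gt0// -EFinM divfK// gt_eqF.
- by rewrite llrE gx eqxx/= mul0e.
- by rewrite fx mule0 lee_fin.
Qed.

(** Truncated from above, so that both its values and its mean under g are
    bounded. *)
Definition tilt (th c : R) x : \bar R := expeR (th%:E * mine (llr f g x) c%:E).

Lemma measurable_tilt th c : measurable_fun setT (tilt th c).
Proof.
apply: measurableT_comp; first exact: measurable_expeR.
apply: measurable_funeM; apply: measurable_mine => //; exact: measurable_llr.
Qed.

Lemma tilt_ge0 th c x : 0 <= tilt th c x.
Proof. exact: expeR_ge0. Qed.

Let tilt_supp th c x : supp x ->
  tilt th c x = (expR (th * Num.min (lr x) c))%:E.
Proof. by move=> sx; rewrite /tilt llr_supp// -EFin_min -EFinM. Qed.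

Lemma tilt_le th c x : (0 <= th)%R -> tilt th c x <= (expR (th * c))%:E.
Proof.
move=> th0; rewrite -[leRHS]/(expeR (th%:E * c%:E)) lee_expeR lee_wpmul2l ?lee_fin//.
by rewrite ge_min lexx orbT.
Qed.

(** The truncated log-likelihood ratio is lr - max (lr - c) 0. Where it is
    negative, it is the log-likelihood ratio itself, and e^{-lr} g = f turns
    the error term into a multiple of f. *)
Let quadratic_bound (th c : R) x : (`|th| <= 2^-1)%R -> (0 <= c)%R -> supp x ->
  (expR (th * Num.min (lr x) c) * g x <=
   comb (16 * th ^+ 2) (1 + th ^+ 2 * (c ^+ 2 * expR c)) th (- th) c x)%R.
Proof.
move=> th1 c0 [fx gx].
have -> : comb (16 * th ^+ 2) (1 + th ^+ 2 * (c ^+ 2 * expR c)) th (- th) c x =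
    ((1 + th * Num.min (lr x) c + th ^+ 2 * (c ^+ 2 * expR c)) * g x +
     16 * th ^+ 2 * f x)%R.
  rewrite /comb /wlr /excess.
  have -> : Num.min (lr x) c = (lr x - Num.max (lr x - c) 0)%R.
    have [lc|lc] := leP (lr x) c.
      by rewrite max_r ?subr0// subr_le0.
    by rewrite max_l ?subr_ge0 ?ltW//; ring.
  ring.
have q0 : (0 <= th ^+ 2 * (c ^+ 2 * expR c))%R.
  by apply: mulr_ge0; rewrite ?sqr_ge0// mulr_ge0 ?sqr_ge0 ?expR_ge0.
have [l0|l0] := leP 0%R (Num.min (lr x) c).
  apply: (@le_trans _ _ ((1 + th * Num.min (lr x) c + th ^+ 2 * (c ^+ 2 * expR c)) * g x)%R).
    rewrite ler_wpM2r// expR_scaled_le_pos// l0/=.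
    by rewrite ge_min lexx orbT.
  by rewrite lerDl mulr_ge0 ?(ltW fx)// mulr_ge0// sqr_ge0.
have lf : (expR (- Num.min (lr x) c) * g x <= f x)%R.
  rewrite min_l; last by move: l0; rewrite gt_min => /orP[/ltW/le_trans->//|]; rewrite ltNge c0.
  by rewrite expRN /lr lnK ?posrE ?divr_gt0// invf_div divfK// gt_eqF.
have h := expR_scaled_le_neg th1 (ltW l0).
have : (expR (th * Num.min (lr x) c) * g x <= (1 + th * Num.min (lr x) c + th ^+ 2 * (16 * expR (- Num.min (lr x) c))) * g x)%R.
  by rewrite ler_wpM2r.
move=> /le_trans; apply.
rewrite !mulrDl -!addrA !lerD2l.
have : (16 * th ^+ 2 * (expR (- Num.min (lr x) c) * g x) <= 16 * th ^+ 2 * f x)%R.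
  by rewrite ler_wpM2l// mulr_ge0// sqr_ge0.
have := mulr_ge0 q0 (g0 x).
lra.
Qed.

Lemma integral_tilt_g_le th c : (`|th| <= 2^-1)%R -> (0 <= c)%R ->
  \int[lambda]_x (tilt th c x * (g x)%:E) <=
  (1 + th * (I - mean_excess c) + th ^+ 2 * (16 + c ^+ 2 * expR c))%:E.
Proof.
move=> th1 c0.
have -> : (1 + th * (I - mean_excess c) + th ^+ 2 * (16 + c ^+ 2 * expR c) =
  16 * th ^+ 2 + (1 + th ^+ 2 * (c ^+ 2 * expR c)) + th * I + (- th) * mean_excess c)%R.
  ring.
apply: integral_g_le => //; first exact: measurable_tilt.
- exact: tilt_ge0.
- by rewrite mulr_ge0// sqr_ge0.
- by rewrite addr_ge0// mulr_ge0 ?sqr_ge0// mulr_ge0 ?sqr_ge0 ?expR_ge0.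
- by move=> x sx; rewrite tilt_supp// -EFinM lee_fin quadratic_bound.
Qed.

(** Under g, the common support of f and g has full measure, and the value
    elsewhere does not change expectations. It is infinite so that a window
    containing such an observation has an infinite product: where g vanishes
    the CUSUM statistic restarts from 0, and no finite value would make
    cusum_inverse_tilt true. *)
Definition inverse_tilt (th : R) x : \bar R :=
  if (f x == 0%R) || (g x == 0%R) then +oo else (expR (- th * lr x))%:E.

Lemma measurable_inverse_tilt th : measurable_fun setT (inverse_tilt th).
Proof.
apply: measurable_fun_ifT => //.
  by apply: measurable_or; exact: measurable_fun_eqr.
apply/measurable_EFinP/(measurableT_comp (@measurable_expR R)).
by apply: measurable_funM => //; exact: measurable_lr.
Qed.

Lemma inverse_tilt_gt0 th x : 0 < inverse_tilt th x.
Proof. by rewrite /inverse_tilt; case: ifP => // _; rewrite lte_fin expR_gt0. Qed.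

(** Only small values of the log-likelihood ratio delay an alarm, so that it
    may be replaced by its truncation and quadratic_bound applies with - th in
    the place of th. *)
Lemma integral_inverse_tilt_le th c : (0 <= th <= 2^-1)%R -> (0 <= c)%R ->
  \int[lambda]_x (inverse_tilt th x * (g x)%:E) <=
  (1 - th * (I - mean_excess c) + th ^+ 2 * (16 + c ^+ 2 * expR c))%:E.
Proof.
move=> /andP[th0 th1] c0.
have -> : (1 - th * (I - mean_excess c) + th ^+ 2 * (16 + c ^+ 2 * expR c) =
  16 * (- th) ^+ 2 + (1 + (- th) ^+ 2 * (c ^+ 2 * expR c)) + (- th) * I +
  (- - th) * mean_excess c)%R.
  ring.
apply: integral_g_le => //; first exact: measurable_inverse_tilt.
- by move=> x; exact/ltW/inverse_tilt_gt0.
- by rewrite mulr_ge0// sqr_ge0.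
- by rewrite addr_ge0// mulr_ge0 ?sqr_ge0// mulr_ge0 ?sqr_ge0 ?expR_ge0.
move=> x sx; rewrite /inverse_tilt !gt_eqF; [|by case: sx..].
rewrite /= -EFinM lee_fin (le_trans _ (quadratic_bound _ c0 sx)) ?normrN ?ger0_norm//.
rewrite ler_wpM2r// ler_expR !mulNr lerN2 ler_wpM2l//.
by rewrite ge_min lexx.
Qed.

(** Change of measure removes one unit from the exponent: e^{lr} f = g. What
    remains is a mean under g of an exponential, bounded below by e^u >= 1 + u;
    on the truncated part the exponent (1 + th) c - lr differs from th * lr by
    (1 + th) (lr - c). *)
Lemma integral_tilt_f_ge th c : (0 <= th)%R -> (0 <= c)%R ->
  (1 + th * I - (1 + th) * mean_excess c)%:E <=
  \int[lambda]_x (tilt (1 + th) c x * (f x)%:E).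
Proof.
move=> th0 c0.
have -> : (1 + th * I - (1 + th) * mean_excess c =
  0 + 1 + th * I + (- (1 + th)) * mean_excess c)%R by ring.
rewrite -int_comb//.
have th10 : (0 <= 1 + th)%R by exact: addr_ge0.
have mtf : measurable_fun setT (fun x => tilt (1 + th) c x * (f x)%:E).
  by apply: emeasurable_funM; [exact: measurable_tilt|exact/measurable_EFinP].
pose u x := (comb 0 1 th (- (1 + th)) c x)%:E.
have mu : measurable_fun setT u by exact/measurable_EFinP.
rewrite -/u integralE; apply: (@le_trans _ _ (\int[lambda]_x u^\+ x)).
  by rewrite geeDl// oppe_le0 integral_ge0.
apply: ae_ge0_le_integral => //.
- exact: measurable_funepos.
- by move=> x _; rewrite mule_ge0 ?tilt_ge0// lee_fin.
apply: filterS ae_supp => x gf _; rewrite funeposE ge_max mule_ge0 ?tilt_ge0 ?lee_fin// andbT.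
have [[fx gx]|/not_supp[gx|[fx gx]]] := pselect (supp x).
- rewrite tilt_supp// -EFinM lee_fin /comb /wlr /excess mul0r add0r mul1r.
  have [lc|lc] := leP (lr x) c.
    rewrite max_r ?subr_le0// mul0r mulr0 addr0.
    have -> : (expR ((1 + th) * lr x) * f x = expR (th * lr x) * g x)%R.
      rewrite mulrDl mul1r expRD {1}/lr lnK ?posrE ?divr_gt0// mulrAC divfK ?gt_eqF//.
      by rewrite mulrC.
    have := ler_wpM2r (ltW gx) (expR_ge1Dx (th * lr x)).
    by rewrite mulrDl mul1r mulrA.
  rewrite max_l; last by rewrite subr_ge0 ltW.
  have -> : (expR ((1 + th) * c) * f x = expR ((1 + th) * c - lr x) * g x)%R.
    rewrite expRD expRN /lr lnK ?posrE ?divr_gt0// invf_div -mulrA divfK ?gt_eqF//.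
  apply: le_trans (ler_wpM2r (ltW gx) (expR_ge1Dx ((1 + th) * c - lr x))).
  by rewrite le_eqVlt; apply/orP; left; apply/eqP; rewrite /lr; ring.
- by rewrite /u /comb /wlr /excess gx !mulr0 mul0r !addr0 mule_ge0 ?tilt_ge0// lee_fin.
- by have := gf gx; rewrite fx ltxx.
Qed.

Lemma integral_overshoot_g_le c : (0 <= c)%R ->
  \int[lambda]_x (maxe (llr f g x - c%:E) 0 * (g x)%:E) <= (mean_excess c)%:E.
Proof.
move=> c0.
have -> : (mean_excess c = 0 + 0 + 0 * I + 1 * mean_excess c)%R by ring.
apply: integral_g_le => //.
- apply: measurable_maxe => //; apply: emeasurable_funB => //; exact: measurable_llr.
- by move=> x; rewrite le_max lexx orbT.
move=> x sx; rewrite llr_supp// -EFinB -EFin_max -EFinM lee_fin.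
by rewrite /comb !mul0r !add0r mul1r.
Qed.

End relative_entropy.

(** * Natural-valued times *)

Section natural_valued.
Context {R : realType}.

Definition natural_valued (v : \bar R) := v = +oo \/ exists n : nat, v = n%:R%:E.

Lemma natural_valued_ge0 (v : \bar R) : natural_valued v -> 0 <= v.
Proof. by move=> [->|[n ->]]; rewrite ?leey// lee_fin. Qed.

Lemma set_ltNle (S : Type) (U : S -> \bar R) (v : \bar R) :
  [set w | v < U w] = ~` [set w | U w <= v].
Proof. by apply/seteqP; split => w /=; rewrite ltNge => /negP. Qed.

Lemma natural_valued_lt (v : \bar R) n :
  natural_valued v -> (n%:R%:E < v) = (n.+1%:R%:E <= v).
Proof.
by move=> [->|[m ->]]; rewrite ?ltry ?leey// lte_fin lee_fin ltr_nat ler_nat.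
Qed.

(** A natural number is the number of naturals below it. *)
Lemma natural_valued_sum (v : \bar R) : natural_valued v ->
  v = \sum_(n <oo) (if n%:R%:E < v then 1 else 0).
Proof.
move=> nv; apply/esym/cvg_lim => //.
have partial m : \sum_(0 <= n < m) (if n%:R%:E < v then 1 else 0) = mine m%:R%:E v.
  elim: m => [|m IH].
    rewrite big_nil min_l//.
    by case: nv => [->|[n ->]]; rewrite ?leey// lee_fin.
  rewrite big_nat_recr//= IH.
  case: nv => [->|[n ->]].
    by rewrite ltry !min_l ?leey// -EFinD natr1.
  rewrite lte_fin ltr_nat; case: ltnP => nm.
    by rewrite !min_l ?lee_fin ?ler_nat// ?(ltnW nm)// -EFinD natr1.
  by rewrite adde0 !min_r// lee_fin ler_nat// ltnW.
under eq_fun do rewrite partial.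
case: nv => [->|[n ->]].
  under eq_fun do rewrite miney.
  exact/cvgenyP/cvg_id.
apply: cvg_near_cst; exists n => // m /= nm.
by rewrite min_r// lee_fin ler_nat.
Qed.

Context {d : measure_display} {T : measurableType d} (P : probability T R).
Variable U : T -> \bar R.
Hypothesis nU : forall w, natural_valued (U w).
Hypothesis mU : forall n : nat, measurable [set w | U w <= n%:R%:E].

Let U_ge0 w : 0 <= U w. Proof. exact: natural_valued_ge0. Qed.

Lemma measurable_tail n : measurable [set w | n%:R%:E < U w].
Proof. by rewrite set_ltNle; exact: measurableC. Qed.

Let above n := [set w | n%:R%:E < U w].

Let UE : U = fun w => \sum_(n <oo) (\1_(above n) w)%:E.
Proof.
apply/funext => w; rewrite {1}(natural_valued_sum (nU w)).
apply: eq_eseriesr => n _; rewrite indicE; case: ifPn => [h|h].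
  by rewrite mem_set.
by rewrite memNset//=; exact/negP.
Qed.

Lemma measurable_natural_valued : measurable_fun setT U.
Proof.
rewrite UE; apply: ge0_emeasurable_sum => // n _.
exact/measurable_EFinP/measurable_indic/measurable_tail.
Qed.

(** The expectation is the sum of the tail probabilities. *)
Lemma integral_natural_valued_le (A : set T) (c : \bar R) : measurable A ->
  (forall m, \sum_(0 <= n < m) P (A `&` [set w | n%:R%:E < U w]) <= c) ->
  \int[P]_(w in A) U w <= c.
Proof.
move=> mA Pc; rewrite UE integral_nneseries//; last first.
  by move=> n; exact/measurable_EFinP/measurable_funTS/measurable_indic/measurable_tail.
apply: lime_le.
  by apply: is_cvg_nneseries => n _ _; apply: integral_ge0 => w _; rewrite lee_fin.
apply: nearW => m; apply: le_trans (Pc m).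
rewrite le_eqVlt; apply/orP; left; apply/eqP; apply: eq_bigr => n _.
by rewrite integral_indic//; [rewrite setIC|exact: measurable_tail].
Qed.

(** Markov's inequality, a time larger than n being at least n + 1. *)
Lemma integral_natural_valued_ge n :
  n.+1%:R%:E * P [set w | n%:R%:E < U w] <= \int[P]_w U w.
Proof.
rewrite -(setIT [set w | _]) -integral_indic//; last exact: measurable_tail.
rewrite -ge0_integralZl//; last first.
  exact/measurable_EFinP/measurable_indic/measurable_tail.
apply: ge0_le_integral => //.
- exact/measurable_funeM/measurable_EFinP/measurable_indic/measurable_tail.
- exact: measurable_natural_valued.
move=> w _; rewrite indicE; have [/set_mem/= h|_] := boolP (w \in _).
  by rewrite mule1 -natural_valued_lt.
by rewrite mule0.
Qed.

End natural_valued.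

(** * Order statistics and alarm times *)

Section order_statistics.
Context {R : realType}.

(** Reduces every comparison of ordered alarm times to counting the sensors
    that have raised an alarm. *)
Lemma order_stat_leP (j : nat) (s : seq (\bar R)) (v : \bar R) :
  (0 < j <= size s)%N -> (order_stat j s <= v) = (j <= count (fun y => (y <= v)%E) s)%N.
Proof.
case: j => // j /andP[_ js]; rewrite /order_stat /=.
rewrite -(permP (permEl (perm_sort <=%O s)) (fun y => y <= v)).
have ss : sorted <=%O (sort <=%O s) by apply: sort_sorted; exact: le_total.
rewrite -(size_sort <=%O s) in js; move: js ss; move: (sort _ s) => {}s js ss.
have mono i k : (i <= k < size s)%N -> nth +oo s i <= nth +oo s k.
  move=> /andP[ik ks].
  by apply: (sorted_leq_nth le_trans le_refl +oo ss) => //; rewrite inE// (leq_ltn_trans ik).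
have [jv|jv] := leP (nth +oo s j) v.
  apply/esym; rewrite -(cat_take_drop j.+1 s) count_cat (leq_trans _ (leq_addr _ _))//.
  have : all (fun y => y <= v) (take j.+1 s).
    apply/(all_nthP +oo) => i; rewrite size_takel// ltnS => ij.
    by rewrite nth_take// (le_trans _ jv)// mono// ij.
  by rewrite all_count size_takel// => /eqP ->.
apply/esym/negbTE; rewrite -ltnNge ltnS -(cat_take_drop j s) count_cat.
rewrite (@eq_in_count _ _ pred0 (drop j s)) ?count_pred0 ?addn0.
  by rewrite (leq_trans (count_size _ _))// size_takel// ltnW.
move=> y /(nthP +oo)[i]; rewrite size_drop nth_drop => ijs <-.
apply/negbTE; rewrite -ltNge (lt_le_trans jv)// mono// leq_addr/=.
by rewrite -ltn_subRL.
Qed.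

Lemma order_stat_mem (j : nat) (s : seq (\bar R)) :
  (0 < j <= size s)%N -> order_stat j s \in s.
Proof.
case: j => // j /andP[_ js]; rewrite /order_stat /= -(mem_sort <=%O).
by rewrite mem_nth// size_sort.
Qed.

Context {I : finType}.

Lemma count_enum_map (A : {set I}) (u : I -> \bar R) v :
  count (fun y => y <= v) [seq u i | i <- enum A] = #|[set i in A | u i <= v]%SET|.
Proof.
rewrite count_map -size_filter cardE; congr size.
rewrite {1}/enum_mem -filter_predI /enum_mem.
by apply: eq_filter => i; rewrite /= !inE andbC.
Qed.

End order_statistics.

Section alarms.
Context {R : realType} {dE : measure_display} {E : measurableType dE} {K : nat}.
Variables f g : E -> R.
Implicit Types (x : nat -> 'I_K -> E) (k : 'I_K) (h : R) (n : nat).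

Lemma alarm_leP h k x n :
  alarm f g h k x <= n%:R%:E <->
  exists2 s, (0 < s <= n)%N & h%:E <= cusum f g x k s.
Proof.
split=> [|[s /andP[s0 sn] hs]]; last first.
  rewrite (@le_trans _ _ s%:R%:E) ?lee_fin ?ler_nat//.
  by apply: ereal_inf_lbound; exists s.
apply: contraPP => nos; apply/negP; rewrite -ltNge.
apply: (@lt_le_trans _ _ n.+1%:R%:E); first by rewrite lte_fin ltr_nat.
apply: le_ereal_inf_tmp => _ [s /= [s0 hs] <-]; rewrite lee_fin ler_nat ltnNge.
by apply/negP => sn; apply: nos; exists s; rewrite ?s0.
Qed.

Lemma alarm_natural h k x : natural_valued (alarm f g h k x).
Proof.
have [[n hn]|none] := pselect (exists n : nat, alarm f g h k x <= n%:R%:E).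
  right; have ex : exists n : nat, alarm f g h k x <= n%:R%:E by exists n.
  have [m hm mmin] := ex_minnP ex; exists m; apply/eqP; rewrite eq_le hm/=.
  apply: le_ereal_inf_tmp => _ [s /= [s0 hs] <-]; rewrite lee_fin ler_nat.
  by apply: mmin; apply/alarm_leP; exists s => //; rewrite s0 leqnn.
left; apply/eqP; rewrite eq_le leey/=; apply: le_ereal_inf_tmp => _ [s /= [s0 hs] <-].
by exfalso; apply: none; exists s; apply/alarm_leP; exists s => //; rewrite s0 leqnn.
Qed.

Lemma alarm_honest_leP (N : {set 'I_K}) j h x v : (0 < j <= #|N|)%N ->
  (alarm_honest f g N j h x <= v) = (j <= #|[set k in N | (alarm f g h k x <= v)%E]%SET|)%N.
Proof. by move=> jN; rewrite order_stat_leP ?count_enum_map// size_map -cardE. Qed.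

Lemma alarm_all_leP j h x v : (0 < j <= K)%N ->
  (alarm_all f g j h x <= v) = (j <= #|[set k | (alarm f g h k x <= v)%E]%SET|)%N.
Proof.
move=> jK; rewrite /alarm_all enumT -enum_setT order_stat_leP ?count_enum_map.
  by congr (_ <= #|pred_of_set _|)%N; apply/setP => k; rewrite !inE.
by rewrite size_map -cardE cardsT card_ord.
Qed.

Lemma alarm_honest_natural (N : {set 'I_K}) j h x : (0 < j <= #|N|)%N ->
  natural_valued (alarm_honest f g N j h x).
Proof.
move=> jN.
have /mapP[k _ ->] : alarm_honest f g N j h x \in [seq alarm f g h k x | k <- enum N].
  by apply: order_stat_mem; rewrite size_map -cardE.
exact: alarm_natural.
Qed.

Lemma alarm_all_natural j h x : (0 < j <= K)%N ->
  natural_valued (alarm_all f g j h x).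
Proof.
move=> jK.
have /mapP[k _ ->] : alarm_all f g j h x \in [seq alarm f g h k x | k <- enum 'I_K].
  by apply: order_stat_mem; rewrite size_map size_enum_ord.
exact: alarm_natural.
Qed.

Lemma eq_cusum x y k k' t : (forall s, (0 < s <= t)%N -> x s k = y s k') ->
  cusum f g x k t = cusum f g y k' t.
Proof.
elim: t => //= t IH xy; rewrite IH ?xy ?leqnn// => s /andP[s0 st].
by rewrite xy// s0 ltnW.
Qed.

Lemma eq_alarm h x y k k' : (forall s, (0 < s)%N -> x s k = y s k') ->
  alarm f g h k x = alarm f g h k' y.
Proof.
move=> xy; congr ereal_inf; apply/seteqP; split=> _ [t /= [t0 ht] <-];
  exists t => //; split=> //; move: ht.
  by rewrite (@eq_cusum x y k k')// => s /andP[s0 _]; exact: xy.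
by rewrite (@eq_cusum x y k k')// => s /andP[s0 _]; exact: xy.
Qed.

(** The reason why the L-th alarm is robust: at most M of the first L alarms
    come from outside N, so at least L - M come from inside. This holds path by
    path, whatever the adversary does. *)
Lemma alarm_honest_le_all (N : {set 'I_K}) M L h x : #|N| = (K - M)%N ->
  (M < K)%N -> (M < L <= K)%N ->
  alarm_honest f g N (L - M) h x <= alarm_all f g L h x.
Proof.
move=> cN MK /andP[ML LK]; have L0 : (0 < L)%N by exact: leq_ltn_trans ML.
rewrite alarm_honest_leP; last by rewrite subn_gt0 ML cN leq_sub2r.
have : (L <= #|[set k | (alarm f g h k x <= alarm_all f g L h x)%E]%SET|)%N.
  by rewrite -alarm_all_leP ?L0.
set v := alarm_all _ _ _ _ _ => Lv.
rewrite leq_subLR (leq_trans Lv)//.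
have -> : [set k in N | alarm f g h k x <= v]%SET =
    ([set k | alarm f g h k x <= v] :&: N)%SET by apply/setP => k; rewrite !inE andbC.
rewrite -(cardsID N [set k | alarm f g h k x <= v]%SET) addnC leq_add2r.
apply: (@leq_trans #|~: N|); last first.
  by rewrite cardsCs finset.setCK card_ord cN subKn// ltnW.
by apply/subset_leq_card/fintype.subsetP => k; rewrite !inE => /andP[].
Qed.

Lemma alarm_all_le_changed (B : {set 'I_K}) L h x v : (0 < L)%N -> (L <= #|B|)%N ->
  (forall k, k \in B -> alarm f g h k x <= v) -> alarm_all f g L h x <= v.
Proof.
move=> L0 LB Bv; rewrite alarm_all_leP.
  by rewrite (leq_trans LB)//; apply/subset_leq_card/fintype.subsetP => k kB; rewrite inE Bv.
by rewrite L0 (leq_trans LB)// -[leqRHS]card_ord max_card.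
Qed.

Lemma alarm_honest_le_changed (N B : {set 'I_K}) j h x v : (0 < j)%N ->
  (j <= #|B|)%N -> B \subset N ->
  (forall k, k \in B -> alarm f g h k x <= v) -> alarm_honest f g N j h x <= v.
Proof.
move=> j0 jB /fintype.subsetP BN Bv; rewrite alarm_honest_leP.
  rewrite (leq_trans jB)//; apply/subset_leq_card/fintype.subsetP => k kB.
  by rewrite inE BN ?Bv.
by rewrite j0 (leq_trans jB)//; apply/subset_leq_card/fintype.subsetP.
Qed.

Context {d : measure_display} {T : measurableType d}.
Variable X : T -> nat -> 'I_K -> E.

Lemma measurable_cusum k t : measurable_fun setT (llr f g) ->
  (forall s, (0 < s <= t)%N -> measurable_fun setT (fun w => X w s k)) ->
  measurable_fun setT (fun w => cusum f g (X w) k t).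
Proof.
move=> ml; elim: t => [|t IH] mX; first exact: measurable_cst.
apply: measurable_maxe => //; apply: emeasurable_funD.
  by apply: IH => s /andP[s0 st]; apply: mX; rewrite s0 ltnW.
by apply: measurableT_comp => //; apply: mX; rewrite leqnn.
Qed.

Lemma measurable_alarm_le h k n : measurable_fun setT (llr f g) ->
  (forall s, (0 < s <= n)%N -> measurable_fun setT (fun w => X w s k)) ->
  measurable [set w | alarm f g h k (X w) <= n%:R%:E].
Proof.
move=> ml mX.
rewrite (_ : mkset _ = \bigcup_(s in [set s | (0 < s <= n)%N])
    [set w | h%:E <= cusum f g (X w) k s]); last first.
  by apply/seteqP; split => w /=; rewrite alarm_leP => -[s]; exists s.
apply: bigcup_measurable => s /= /andP[s0 sn].
rewrite -[mkset _]setTI; apply: emeasurable_fun_c_infty => //.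
apply: measurable_cusum => // u /andP[u0 us]; apply: mX.
by rewrite u0 (leq_trans us).
Qed.

(** At least j alarms have been raised in N when some subset of N with at least
    j elements consists of sensors with an alarm; there are finitely many
    subsets. *)
Lemma measurable_alarm_count_le (N : {set 'I_K}) j h n :
  measurable_fun setT (llr f g) ->
  (forall s k, (0 < s <= n)%N -> k \in N -> measurable_fun setT (fun w => X w s k)) ->
  measurable [set w | (j <= #|[set k in N | (alarm f g h k (X w) <= n%:R%:E)%E]%SET|)%N].
Proof.
move=> ml mX.
pose U (A : {set 'I_K}) : set T :=
  \bigcap_(k in [set k | k \in A]) [set w | alarm f g h k (X w) <= n%:R%:E].
rewrite (_ : mkset _ = \bigcup_(A in [set A : {set 'I_K} | (A \subset N) && (j <= #|A|)%N]) U A).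
  apply: fin_bigcup_measurable; first exact: finite_finset.
  move=> A /andP[/fintype.subsetP AN _]; apply: fin_bigcap_measurable => //.
  move=> k /= kA; apply: measurable_alarm_le => // s sn.
  by apply: mX => //; exact: AN.
apply/seteqP; split => w /=.
  move=> jw; exists [set k in N | alarm f g h k (X w) <= n%:R%:E]%SET => /=.
    by rewrite jw andbT; apply/fintype.subsetP => k; rewrite inE => /andP[].
  by move=> k /=; rewrite inE => /andP[].
move=> [A /andP[/fintype.subsetP AN jA] Aw]; apply: (leq_trans jA).
by apply/subset_leq_card/fintype.subsetP => k kA; rewrite inE AN//=; exact: Aw.
Qed.

End alarms.

(** * The CUSUM statistic and its exponential tilts *)

Section cusum_and_powers.
Context {R : realType} {dE : measure_display} {E : measurableType dE} {K : nat}.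
Variables f g : E -> R.
Implicit Types (x : nat -> 'I_K -> E) (k : 'I_K).

Let expeR_max (a b : \bar R) : expeR (maxe a b) = maxe (expeR a) (expeR b).
Proof. by rewrite !maxEle lee_expeR; case: ifP. Qed.

Let pmuleDr (th : R) (a b : \bar R) : (0 < th)%R ->
  th%:E * (a + b) = th%:E * a + th%:E * b.
Proof.
move=> th0; have p : (0 : \bar R) < th%:E by rewrite lte_fin.
case: a => [a| |]; case: b => [b| |] //; rewrite -?EFinD -?EFinM ?mulrDr ?EFinD//;
  by rewrite ?(gt0_muley p) ?(gt0_muleNy p)// ?addey ?addeNy ?addye ?addNye// gt0_muleNy.
Qed.

Let expeR_pmax (th : R) (a b : \bar R) : (0 < th)%R ->
  expeR (th%:E * maxe (a + b) 0) =
  maxe (expeR (th%:E * a) * expeR (th%:E * b)) 1.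
Proof.
move=> th0; rewrite maxe_pMr ?lee_fin ?(ltW th0)// mule0.
by rewrite expeR_max expeR0 pmuleDr// expeRD.
Qed.

Lemma cusum_ge0 x k t : 0 <= cusum f g x k t.
Proof. by case: t => //= t; rewrite le_max lexx orbT. Qed.

Lemma expeR_cusum x k t :
  expeR (cusum f g x k t) = mcusum (fun y => expeR (llr f g y)) x k t.
Proof.
elim: t => [|t IH] /=; first by rewrite expR0.
by rewrite expeR_max expeRD IH expeR0.
Qed.

(** Truncation makes the increments smaller, hence also the statistic: when the
    truncated tilt crosses e^{th h}, the CUSUM statistic has crossed h. *)
Lemma mcusum_tilt_le th c x k t : (0 < th)%R ->
  mcusum (tilt f g th c) x k t <= expeR (th%:E * cusum f g x k t).
Proof.
move=> th0; elim: t => [|t IH]; first by rewrite mule0 expeR0.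
rewrite [cusum _ _ _ _ _]/= expeR_pmax// [mcusum _ _ _ _]/=.
rewrite ge_max !le_max lexx orbT andbT; apply/orP; left; apply: lee_pmul => //.
- exact: mcusum_ge0.
- exact: expeR_ge0.
- by rewrite lee_expeR lee_wpmul2l ?lee_fin ?(ltW th0)// ge_min lexx.
Qed.

(** Not reflected, hence nondecreasing in time; its mean is linear in time. *)
Fixpoint overshoot (c : R) x k t : \bar R :=
  if t is s.+1 then overshoot c x k s + maxe (llr f g (x t k) - c%:E) 0 else 0.

Lemma overshoot_nondecreasing c x k s t : (s <= t)%N ->
  overshoot c x k s <= overshoot c x k t.
Proof.
elim: t => [|t IH]; first by rewrite leqn0 => /eqP ->.
rewrite leq_eqVlt => /predU1P[->//|]; rewrite ltnS => /IH /le_trans; apply.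
by rewrite /= leeDl// le_max lexx orbT.
Qed.

(** Each increment is its truncation plus its overshoot, and adding a
    nonnegative increment raises a reflected sum by at most that increment. So
    a crossing by the CUSUM statistic comes either from the truncated statistic
    or from the total overshoot. *)
Lemma expeR_cusum_le_tilt th c x k t : (0 < th)%R ->
  expeR (th%:E * cusum f g x k t) <=
  mcusum (tilt f g th c) x k t * expeR (th%:E * overshoot c x k t).
Proof.
move=> th0; elim: t => [|t IH]; first by rewrite !mule0 expeR0 mule1.
have o0 : 1 <= expeR (th%:E * overshoot c x k t.+1).
  rewrite -[1]expeR0 lee_expeR mule_ge0 ?lee_fin ?(ltW th0)//.
  exact: (overshoot_nondecreasing _ _ _ (leq0n t.+1)).
rewrite [cusum _ _ _ _ _]/= expeR_pmax// ge_max; apply/andP; split; last first.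
  by rewrite -[1]mule1 lee_pmul// mcusum_ge1.
apply: (@le_trans _ _ (mcusum (tilt f g th c) x k t * tilt f g th c (x t.+1 k) *
    expeR (th%:E * overshoot c x k t.+1))); last first.
  by rewrite lee_wpmul2r ?expeR_ge0//= le_max lexx.
rewrite [overshoot _ _ _ _]/= pmuleDr// expeRD muleACA.
apply: lee_pmul; rewrite ?expeR_ge0//.
rewrite -expeRD lee_expeR -pmuleDr// lee_wpmul2l ?lee_fin ?(ltW th0)//.
case: (llr f g _) => [l| |]//=.
- rewrite -EFin_min -EFinB -EFin_max -EFinD lee_fin.
  have [lc|lc] := leP l c; first by rewrite max_r ?addr0// subr_le0.
  by rewrite max_l; [lra|rewrite subr_ge0 ltW].
- by rewrite leNye.
Qed.

(** A reflected sum is at least the sum of its last j increments. A sensor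
    silent at nu + j therefore has had a small sum, that is, a large product of
    inverse tilts, over the window after nu, regardless of what happened before
    nu. *)
Lemma cusum_inverse_tilt (lambda : {sigma_finite_measure set E -> \bar R})
    th x k nu j :
  is_density lambda f -> is_density lambda g -> (0 < th)%R ->
  1 <= expeR (th%:E * cusum f g x k (nu + j)) *
       window (inverse_tilt f g th) x k nu j.
Proof.
move=> df dg th0; have [_ f0 _] := df; have [_ g0 _] := dg.
have Y1 t : 1 <= expeR (th%:E * cusum f g x k t).
  by rewrite -[1]expeR0 lee_expeR mule_ge0 ?cusum_ge0 ?lee_fin ?(ltW th0).
have w0 i : 0 < window (inverse_tilt f g th) x k nu i.
  by elim: i => //= i IH; rewrite mule_gt0// inverse_tilt_gt0.
elim: j => [|j IH]; first by rewrite mule1 Y1.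
rewrite [window _ _ _ _ _]/= addnS.
set y := x (nu + j).+1 k.
have [fg0|] := boolP ((f y == 0%R) || (g y == 0%R)).
  rewrite {2}/inverse_tilt fg0 (gt0_muley (w0 j)) gt0_muley ?leey//.
  exact: lt_le_trans (Y1 _).
rewrite negb_or => /andP[fy gy].
have sy : supp f g y by split; rewrite lt_neqAle eq_sym ?fy ?gy ?f0 ?g0.
rewrite [cusum _ _ _ _ _]/= expeR_pmax//.
apply: (@le_trans _ _ (expeR (th%:E * cusum f g x k (nu + j)) *
    expeR (th%:E * llr f g (x (nu + j).+1 k)) *
    (window (inverse_tilt f g th) x k nu j *
     inverse_tilt f g th (x (nu + j).+1 k)))); last first.
  apply: lee_wpmul2r; last by rewrite le_max lexx.
  by apply: mule_ge0; [exact: ltW (w0 _)|exact/ltW/inverse_tilt_gt0].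
rewrite muleACA (llr_supp df dg)// {2}/inverse_tilt (negbTE fy) (negbTE gy).
have -> : expeR (th%:E * (lr f g y)%:E) *
    (if false || false then +oo else (expR (- th * lr f g y))%:E) = 1.
  by rewrite -EFinM /= -expRD mulNr subrr expR0.
by rewrite mule1.
Qed.

End cusum_and_powers.

(** * Alarms of a single sensor *)

Section sensor_alarms.
Context {R : realType} {d dE : measure_display}.
Context {T : measurableType d} {E : measurableType dE} {K : nat}.
Variables (N : {set 'I_K}) (X : T -> nat -> 'I_K -> E) (P : probability T R).
Hypothesis mX : forall t k, (0 < t)%N -> k \in N ->
  measurable_fun setT (fun w => X w t k).
Hypothesis indX :
  mutually_independent P [set i : nat * 'I_K | (0 < i.1)%N && (i.2 \in N)]
    (fun i w => X w i.1 i.2).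
Variables (lambda : {sigma_finite_measure set E -> \bar R}) (f g : E -> R).
Hypotheses (df : is_density lambda f) (dg : is_density lambda g).
Hypothesis KLy : KL lambda f g < +oo.

Definition law_after (k : 'I_K) nu (dens : E -> R) :=
  forall t (A : set E), (nu < t)%N -> measurable A ->
    P [set w | A (X w t k)] = \int[lambda]_(x in A) (dens x)%:E.

Let I := fine (KL lambda f g).
Let rho := mean_excess lambda f g.
Let Q (c : R) := (16 + c ^+ 2 * expR c)%R.

Let expect k nu dens (phi : E -> \bar R) t : is_density lambda dens ->
  law_after k nu dens -> k \in N -> (nu < t)%N -> measurable_fun setT phi ->
  (forall x, 0 <= phi x) ->
  \int[P]_w phi (X w t k) = \int[lambda]_x (phi x * (dens x)%:E).
Proof.
move=> dd law kN nt mphi phi0.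
apply: integral_density => //; first exact/mX/kN/(leq_ltn_trans _ nt).
by move=> A mA; exact: law.
Qed.

Let mllr : measurable_fun setT (llr f g).
Proof. exact: measurable_llr df dg. Qed.

Lemma measurable_sensor_alarm h k n : k \in N ->
  measurable [set w | alarm f g h k (X w) <= n%:R%:E].
Proof.
by move=> kN; apply: measurable_alarm_le => // s /andP[s0 _]; exact: mX.
Qed.

(** Without a change, the likelihood ratio has mean at most 1: no exponential
    growth in the crossing bound. *)
Lemma alarm_early_null k (h : R) n : k \in N -> law_after k 0 f -> (0 <= h)%R ->
  P [set w | alarm f g h k (X w) <= n%:R%:E] <= (n.+1%:R / expR h)%:E.
Proof.
move=> kN law h0.
rewrite (_ : mkset _ =
    [set w | crossed (fun y => expeR (llr f g y)) (expR h) k n (X w)]); last first.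
  apply/seteqP; split => w /=; rewrite alarm_leP => -[s sn].
    by rewrite -lee_expeR expeR_cusum; exists s.
  by rewrite -expeR_cusum -[(expR h)%:E]/(expeR h%:E) lee_expeR; exists s.
have mphi : measurable_fun setT (fun y => expeR (llr f g y)).
  by apply: measurableT_comp => //; exact: measurable_expeR.
have h1 : (1 <= expR h)%R by rewrite -expR0 ler_expR.
have := crossing_probability_le mX indX mphi (fun=> expeR_ge0 _) kN h1 (lexx 1%R) (n := n).
rewrite expr1n mulr1; apply => t /andP[t0 _].
rewrite (expect (phi := fun y => expeR (llr f g y)) df law)//; last first.
  by move=> x; exact: expeR_ge0.
exact: integral_likelihood_ratio_le df dg.
Qed.

Let mexc c : measurable_fun setT (fun y => maxe (llr f g y - c%:E) 0).
Proof. by apply: measurable_maxe => //; exact: emeasurable_funB. Qed.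

Lemma measurable_overshoot c k n : k \in N ->
  measurable_fun setT (fun w => overshoot f g c (X w) k n).
Proof.
move=> kN; elim: n => [|n IH]; first exact: measurable_cst.
exact: (emeasurable_funD IH (measurableT_comp (mexc c) (mX (ltn0Sn n) kN))).
Qed.

Lemma integral_overshoot_le c k n : k \in N -> law_after k 0 g -> (0 <= c)%R ->
  \int[P]_w overshoot f g c (X w) k n <= (n%:R * rho c)%:E.
Proof.
move=> kN law c0; elim: n => [|n IH]; first by rewrite integral0 mul0r.
have o0 w : 0 <= overshoot f g c (X w) k n.
  exact: (overshoot_nondecreasing _ _ _ _ _ (leq0n n)).
have exc0 y : 0 <= maxe (llr f g y - c%:E) 0 by rewrite le_max lexx orbT.
rewrite ge0_integralD//; last 2 first.
- exact: measurable_overshoot.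
- by apply: (measurableT_comp (mexc c)); exact: mX.
rewrite -natr1 mulrDl mul1r EFinD leeD//.
rewrite (expect (phi := fun y => maxe (llr f g y - c%:E) 0) dg law)//.
exact: integral_overshoot_g_le df dg KLy _ c0.
Qed.

(** An alarm at level h requires the truncated CUSUM statistic to reach (1 -
    eta) h, or the total overshoot to reach eta h. The first event is
    controlled by the growth rate of the tilted statistic, the second by
    Markov's inequality. *)
Lemma alarm_early_changed k (h th c eta : R) n : k \in N -> law_after k 0 g ->
  (0 < KL lambda f g) -> (0 < h)%R -> (0 < th <= 2^-1)%R -> (0 <= c)%R ->
  (0 < eta < 1)%R ->
  P [set w | alarm f g h k (X w) <= n%:R%:E] <=
  (n.+1%:R * (1 + th * I + th ^+ 2 * Q c) ^+ n / expR (th * ((1 - eta) * h)) +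
   n%:R * rho c / (eta * h))%:E.
Proof.
move=> kN law KL0 h0 /andP[th0 th1] c0 /andP[eta0 eta1].
have I0 : (0 <= I)%R by exact/fine_ge0/ltW.
set b := expR (th * ((1 - eta) * h)).
pose C := [set w | crossed (tilt f g th c) b k n (X w)].
pose O := [set w | (eta * h)%:E <= overshoot f g c (X w) k n].
have mC : measurable C.
  apply: measurable_crossed => [|s /andP[s0 _]]; last exact: mX.
  exact: measurable_tilt df dg _ _.
have mO : measurable O.
  rewrite -(setTI O); apply: emeasurable_fun_c_infty => //.
  exact: measurable_overshoot.
have sub : [set w | alarm f g h k (X w) <= n%:R%:E] `<=` C `|` O.
  move=> w /= /alarm_leP[s sn hs].
  have [Ow|Ow] := leP (eta * h)%:E (overshoot f g c (X w) k n); [by right|left].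
  exists s => //; have := expeR_cusum_le_tilt f g c (X w) k s th0.
  have : expeR (th%:E * h%:E) <= expeR (th%:E * cusum f g (X w) k s).
    by rewrite lee_expeR lee_wpmul2l// lee_fin ltW.
  move=> /le_trans h1 /h1{h1}.
  have : expeR (th%:E * overshoot f g c (X w) k s) <= (expR (th * (eta * h)))%:E.
    rewrite -[leRHS]/(expeR (th%:E * (eta * h)%:E)) lee_expeR.
    apply: lee_wpmul2l; first by rewrite lee_fin ltW.
    apply: le_trans (ltW Ow); apply: overshoot_nondecreasing.
    by case/andP: sn.
  move=> oh /le_trans/(_ (lee_wpmul2l (mcusum_ge0 _ _ _ _) oh)).
  rewrite -EFinM /= -lee_pdivrMr ?expR_gt0// -EFinM -expRN -expRD.
  by apply: le_trans; rewrite lee_fin ler_expR; lra.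
apply: (@le_trans _ _ (P C + P O)).
  apply: le_trans (measureU2 _ mC mO); apply: le_measure => //; rewrite ?inE//.
    exact: measurable_sensor_alarm.
  exact: measurableU.
rewrite EFinD leeD//.
  have b1 : (1 <= b)%R.
    rewrite -expR0 ler_expR !mulr_ge0 ?(ltW th0) ?(ltW h0)//; lra.
  apply: (crossing_probability_le mX indX _ (@tilt_ge0 _ _ _ f g th c) kN b1) => //.
  - exact: measurable_tilt df dg _ _.
  - rewrite -addrA lerDl addr_ge0// ?mulr_ge0 ?(ltW th0)// ?sqr_ge0//.
    by rewrite addr_ge0// mulr_ge0 ?sqr_ge0 ?expR_ge0.
  move=> t /andP[t0 _]; rewrite (expect dg law)//; last 2 first.
  - exact: measurable_tilt df dg _ _.
  - exact: tilt_ge0.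
  have := integral_tilt_g_le df dg KLy (th := th) _ c0.
  rewrite ger0_norm ?(ltW th0)// => /(_ th1) /le_trans; apply.
  rewrite lee_fin lerD2r lerD2l ler_wpM2l ?(ltW th0)// gerBl.
  by apply/fine_ge0/integral_ge0 => x _; rewrite lee_fin mulr_ge0 ?le_max ?lexx ?orbT//; case: dg.
have eh : (0 < eta * h)%R by exact: mulr_gt0.
rewrite EFinM lee_pdivlMr// muleC.
apply: le_trans (integral_overshoot_le n kN law c0).
have o0 w : 0 <= overshoot f g c (X w) k n.
  exact: (overshoot_nondecreasing _ _ _ _ _ (leq0n n)).
have := le_integral_abse P measurableT (measurable_overshoot c n kN) eh.
under [in X in _ <= X -> _]eq_integral do rewrite gee0_abs//.
apply: le_trans; rewrite lee_wpmul2l// ?lee_fin ?(ltW eh)// setTI.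
rewrite le_eqVlt; apply/orP; left; apply/eqP; congr (P _).
by apply/seteqP; split => w /=; rewrite gee0_abs.
Qed.

(** The tilt by 1 + th has mean larger than 1 under f, as soon as the
    truncation level makes mean_excess small; so it crosses e^{(1 + th) h} in a
    mean time of that order. *)
Lemma survival_sum_null k (h th c kappa : R) n : k \in N -> law_after k 0 f ->
  (0 <= h)%R -> (0 <= th)%R -> (0 <= c)%R ->
  (0 <= kappa <= th * I - (1 + th) * rho c)%R ->
  kappa%:E * \sum_(0 <= t < n) P [set w | t%:R%:E < alarm f g h k (X w)] <=
  (expR ((1 + th) * h) * expR ((1 + th) * c))%:E.
Proof.
move=> kN law h0 th0 c0 /andP[k0 kle].
have th1 : (0 < 1 + th)%R by rewrite ltr_pwDl.
have b1 : (1 <= expR ((1 + th) * h))%R by rewrite -[leLHS]expR0 ler_expR mulr_ge0 ?(ltW th1).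
have M1 : (1 <= expR ((1 + th) * c))%R by rewrite -[leLHS]expR0 ler_expR mulr_ge0 ?(ltW th1).
have mt : measurable_fun setT (tilt f g (1 + th) c) by exact: measurable_tilt df dg _ _.
apply: le_trans (sum_survival_le mX indX mt (@tilt_ge0 _ _ _ f g (1 + th) c) kN b1 n M1 k0 _ _).
- apply: lee_wpmul2l; first by rewrite lee_fin.
  apply: lee_sum => t _; apply: le_measure; rewrite ?inE.
  + by rewrite set_ltNle; exact/measurableC/measurable_sensor_alarm.
  + apply: measurableC; apply: measurable_crossed => // s /andP[s0 _]; exact: mX.
  move=> w /= ta [s sn bs]; move: ta; rewrite ltNge => /negP; apply.
  apply/alarm_leP; exists s => //.
  have := le_trans bs (mcusum_tilt_le f g c (X w) k s th1).
  by rewrite -[leLHS]/(expeR ((1 + th)%:E * h%:E)) lee_expeR lee_pmul2l// lte_fin.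
- by move=> x; apply: tilt_le; exact: ltW.
move=> t t0; rewrite (expect df law)//; last exact: tilt_ge0.
apply: le_trans (integral_tilt_f_ge df dg KLy th0 c0).
by rewrite lee_fin -addrA lerD2l.
Qed.

(** When r < 1 this is a geometric tail for the delay of a changed sensor,
    uniform over nu and over the events A of the past. *)
Lemma delay_tail_changed k (h th c r : R) nu j (A : set T) : k \in N ->
  law_after k nu g -> (0 < h)%R -> (0 < th <= 2^-1)%R -> (0 <= c)%R -> (0 <= r)%R ->
  (1 - th * (I - rho c) + th ^+ 2 * Q c <= r)%R ->
  sigma_of (past N nu) (fun i w => X w i.1 i.2) A ->
  P (A `&` [set w | (nu + j)%N%:R%:E < alarm f g h k (X w)]) <=
  (expR (th * h) * r ^+ j)%:E * P A.
Proof.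
move=> kN law h0 /andP[th0 th1] c0 r0 rle sA.
have mit : measurable_fun setT (inverse_tilt f g th) by exact: measurable_inverse_tilt df dg _.
apply: (window_probability_le mX indX mit (fun x => ltW (inverse_tilt_gt0 f g th x)) kN
  _ r0 sA).
- exact: expR_ge0.
- by rewrite set_ltNle; exact/measurableC/measurable_sensor_alarm.
- move=> t nt; rewrite (expect dg law)//; last by move=> x; exact/ltW/inverse_tilt_gt0.
  apply: (le_trans (integral_inverse_tilt_le df dg KLy _ c0)); first by rewrite ltW.
  by rewrite lee_fin.
move=> w /= late.
apply: (le_trans (cusum_inverse_tilt (X w) k nu j df dg th0)).
apply: lee_wpmul2r.
  by elim: (j) => //= i IH; rewrite mule_ge0// ltW// inverse_tilt_gt0.
rewrite -[leRHS]/(expeR (th%:E * h%:E)) lee_expeR; apply: lee_wpmul2l.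
  by rewrite lee_fin ltW.
have [nj0|nj0] := posnP (nu + j)%N; first by rewrite nj0/= lee_fin ltW.
rewrite leNgt; apply/negP => /ltW hY; move: late; rewrite ltNge => /negP; apply.
by apply/alarm_leP; exists (nu + j)%N => //; rewrite nj0 leqnn.
Qed.

End sensor_alarms.

(** * The adversary *)

(** Allows a function of a path to be measured through the path itself: applied
    to the map from outcomes to the histories that the adversary sees, and to
    the attacked paths. *)
Lemma sigma_of_preimage {d dE} {T : measurableType d} {E : measurableType dE}
    (S I : Type) (D : set I) (Z : I -> S -> E) (H : T -> S) (A : set S) :
  (forall i, D i -> measurable_fun setT (fun w => Z i (H w))) ->
  sigma_of D Z A -> measurable (H @^-1` A).
Proof.
move=> mZ; apply: (smallest_sub (X := [set A | measurable (H @^-1` A)])).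
  split; rewrite /= ?preimage_set0//.
    by move=> B mB; rewrite /= setTD preimage_setC; exact: measurableC.
  by move=> F mF; rewrite /= preimage_bigcup; exact: bigcupT_measurable.
move=> _ [i Di [B mB <-]] /=; rewrite setTI.
by have := mZ i Di measurableT B mB; rewrite setTI.
Qed.

Section adversary_lemmas.
Context {d dE : measure_display} {T : measurableType d} {E : measurableType dE}.
Context {K : nat} (N : {set 'I_K}).
Variable X : T -> nat -> 'I_K -> E.

Lemma attack_honest (pi : forall t, history (E := E) N t -> 'I_K -> E) x k t :
  k \in N -> attack pi x t k = x t k.
Proof. by rewrite /attack => ->. Qed.

Lemma measurable_attack (pi : forall t, history (E := E) N t -> 'I_K -> E) n :
  is_strategy pi ->
  (forall s k, (0 < s <= n)%N -> k \in N -> measurable_fun setT (fun w => X w s k)) ->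
  forall s k, (0 < s <= n)%N -> measurable_fun setT (fun w => attack pi (X w) s k).
Proof.
move=> spi mX s k sn; rewrite /attack; case: (boolP (k \in N)) => kN; first exact: mX.
move=> _ B mB; rewrite setTI.
pose H w : history (E := E) N s := fun (u : 'I_s) (j : {j : 'I_K | j \in N}) =>
  X w u.+1 (val j).
have := sigma_of_preimage (H := H) _ (spi s k B mB); apply => -[u j] _ /=.
apply: mX; last exact: (valP j).
by rewrite /= (leq_trans (ltn_ord u))//; case/andP: sn.
Qed.

End adversary_lemmas.

Lemma set_in_setT (I : finType) (p : pred I) :
  [set i in [set: I]%SET | p i]%SET = [set i | p i]%SET.
Proof. by apply/setP => i; rewrite !inE. Qed.

Lemma alarm_all_stopping_time {R : realType} {dE} {E : measurableType dE}
    {K : nat} (f g : E -> R) L h : measurable_fun setT (llr f g) -> (0 < L <= K)%N ->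
  stopping_time (K := K) (alarm_all f g L h).
Proof.
move=> ml LK; split; first by move=> x; exact: alarm_all_natural.
move=> t; pose Z (i : nat * 'I_K) (x : obs_path (E := E) K) := x i.1 i.2.
pose D := [set i : nat * 'I_K | (0 < i.1 <= t)%N].
rewrite (_ : mkset _ = [set x | (L <= #|[set k in [set: 'I_K]%SET |
    (alarm f g h k x <= t%:R%:E)%E]%SET|)%N]).
  apply: (measurable_alarm_count_le (T := g_sigma_algebraType (gen_of D Z)) (X := id)) => //.
  by move=> s k st _; apply: (adapted_coord (i := (s, k))).
by apply/seteqP; split => x /=; rewrite alarm_all_leP// set_in_setT.
Qed.

Section false_alarms.
Context {R : realType} {d dE : measure_display}.
Context {T : measurableType d} {E : measurableType dE} {K : nat}.
Variables (M L : nat) (N : {set 'I_K}) (f g : E -> R) (h : R).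
Variables (X : T -> nat -> 'I_K -> E) (P : probability T R).
Hypotheses (MK : (M < K)%N) (cN : #|N| = (K - M)%N) (MLK : (M < L <= K)%N).
Hypothesis mX : forall t k, (0 < t)%N -> k \in N ->
  measurable_fun setT (fun w => X w t k).
Hypothesis mllr : measurable_fun setT (llr f g).

Let LK : (0 < L <= K)%N.
Proof. by case/andP: MLK => ML ->; rewrite (leq_ltn_trans _ ML). Qed.

Lemma honest_rank : (0 < L - M <= #|N|)%N.
Proof. by case/andP: MLK => ML LK'; rewrite subn_gt0 ML cN leq_sub2r. Qed.

Lemma measurable_alarm_honest n :
  measurable [set w | alarm_honest f g N (L - M) h (X w) <= n%:R%:E].
Proof.
rewrite (_ : mkset _ = [set w | (L - M <= #|[set k in N |
    (alarm f g h k (X w) <= n%:R%:E)%E]%SET|)%N]).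
  by apply: measurable_alarm_count_le => // s k /andP[s0 _]; exact: mX.
by apply/seteqP; split => w /=; rewrite alarm_honest_leP// honest_rank.
Qed.

Lemma measurable_alarm_attack (pi : forall t, history (E := E) N t -> 'I_K -> E) n :
  is_strategy pi ->
  measurable [set w | alarm_all f g L h (attack pi (X w)) <= n%:R%:E].
Proof.
move=> spi; rewrite (_ : mkset _ = [set w | (L <= #|[set k in [set: 'I_K]%SET |
    (alarm f g h k (attack pi (X w)) <= n%:R%:E)%E]%SET|)%N]).
  apply: (measurable_alarm_count_le (X := fun w => attack pi (X w))) => //.
  move=> s k sn _; apply: (measurable_attack (n := n)) => // u j /andP[u0 _].
  exact: mX.
by apply/seteqP; split => w /=; rewrite alarm_all_leP// set_in_setT.
Qed.

Lemma alarm_attack (pi : forall t, history (E := E) N t -> 'I_K -> E) x k :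
  k \in N -> alarm f g h k (attack pi x) = alarm f g h k x.
Proof. by move=> kN; apply: eq_alarm => s _; exact: attack_honest. Qed.

Lemma alarm_honest_attack (pi : forall t, history (E := E) N t -> 'I_K -> E) x :
  alarm_honest f g N (L - M) h (attack pi x) = alarm_honest f g N (L - M) h x.
Proof.
congr order_stat; apply/eq_in_map => k; rewrite mem_enum => kN.
exact: alarm_attack.
Qed.

Lemma integral_alarm_attack_ge (pi : forall t, history (E := E) N t -> 'I_K -> E) :
  is_strategy pi ->
  \int[P]_w alarm_honest f g N (L - M) h (X w) <=
  \int[P]_w alarm_all f g L h (attack pi (X w)).
Proof.
move=> spi; apply: ge0_le_integral => //.
- by move=> w _; exact/natural_valued_ge0/alarm_honest_natural/honest_rank.
- apply: measurable_natural_valued => [w|n]; last exact: measurable_alarm_honest.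
  exact/alarm_honest_natural/honest_rank.
- apply: measurable_natural_valued => [w|n]; last exact: measurable_alarm_attack.
  exact: alarm_all_natural.
by move=> w _; rewrite -(alarm_honest_attack pi) alarm_honest_le_all.
Qed.

End false_alarms.

(** If the conditional expectation were at least c + 1 / (m + 1) on an event of
    G of positive probability, integrating over that event would contradict the
    bound. *)
Lemma ess_sup_cond_exp_le {R : realType} {d} {T : measurableType d}
    (P : probability T R) (G : set (set T)) (Z Y : T -> \bar R) (c : R) :
  (forall A, G A -> measurable A) -> is_cond_exp P G Z Y -> (0 <= c)%R ->
  (forall A, G A -> \int[P]_(w in A) Z w <= c%:E * P A) -> ess_sup P Y <= c%:E.
Proof.
move=> mG [Y0 YG YZ] c0 Zc.
have mY : measurable_fun setT Y by move=> _ B mB; rewrite setTI; exact/mG/YG.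
pose lev (m : nat) : R := (c + m.+1%:R^-1)%R.
pose A m := Y @^-1` [set y | (lev m)%:E <= y].
have GA m : G (A m).
  apply: YG; rewrite -[mkset _]setTI.
  exact: (emeasurable_fun_c_infty (f := id)).
have A0 m : P (A m) = 0.
  have lec : (lev m)%:E * P (A m) <= c%:E * P (A m).
    apply: le_trans (Zc _ (GA m)); rewrite -YZ//.
    rewrite -integral_cst; last exact: mG.
    apply: ge0_le_integral => //; first exact: mG.
    - by move=> w _; rewrite lee_fin addr_ge0.
    - by apply: measurable_funTS.
  have : (m.+1%:R^-1)%:E * P (A m) <= 0.
    have pf : P (A m) \is a fin_num by rewrite fin_num_measure//; exact: mG.
    move: lec; rewrite /lev EFinD ge0_muleDl ?lee_fin// -leeBrDl; last first.
      by rewrite fin_numM.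
    by rewrite subee// fin_numM.
  move=> le0; apply/eqP; rewrite eq_le measure_ge0 andbT.
  by move: le0; rewrite pmule_rle0// lte_fin invr_gt0.
have : \forall w \ae P, forall m, ~ A m w.
  apply: ae_foralln => m; exists (A m); split; [exact: mG|exact: A0|].
  by move=> w /= /contrapT.
move=> nA; apply/ess_supP; apply: filterS nA => w nA; rewrite leNgt; apply/negP => cY.
have [m hm] : exists m : nat, (lev m)%:E <= Y w.
  move: cY; case: (Y w) => [y| |//]; last by exists 0%N; rewrite leey.
  by rewrite lte_fin => /ltr_add_invr[m /ltW hm]; exists m; rewrite lee_fin.
exact: (nA m).
Qed.

(** The corrupt observations are functions of the honest ones, so that what is
    observed up to nu carries no more information than the honest past. *)
Lemma sigma_of_attack {d dE} {T : measurableType d} {E : measurableType dE}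
    {K : nat} (N : {set 'I_K}) (X : T -> nat -> 'I_K -> E)
    (pi : forall t, history (E := E) N t -> 'I_K -> E) nu A :
  is_strategy pi ->
  preimage_set_system setT (fun w => attack pi (X w)) (filtration nu) A ->
  sigma_of (past N nu) (fun i w => X w i.1 i.2) A.
Proof.
move=> spi [F FF <-]; rewrite setTI.
apply: (sigma_of_preimage (T := g_sigma_algebraType (gen_of (past N nu) (fun i w => X w i.1 i.2))) _ FF).
move=> -[s k] /= sn; apply: (measurable_attack (n := nu) (X := X) (T := g_sigma_algebraType (gen_of (past N nu) (fun i w => X w i.1 i.2)))) => //.
move=> u j un jN; apply: (adapted_coord (i := (u, j))).
by rewrite /past/= un.
Qed.

Lemma sigma_of_cst {dE} {E : measurableType dE} (J S : Type) (D : set J)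
    (Z : J -> S -> E) (p : Prop) : sigma_of D Z (fun _ : S => p).
Proof.
move=> G [[G0 GC _] _]; have [pT|pF] := pselect p.
  have e : [set: S] = (fun=> p) by apply/seteqP; split.
  by move: (GC _ G0); rewrite setD0 e.
have e : @set0 S = (fun=> p) by apply/seteqP; split.
by move: G0; rewrite e.
Qed.

(** The adversary of the lower bound on the delay. A corrupt sensor that copies
    an honest one raises its alarm together with it, so that no alarm precedes
    the first alarm among the honest sensors. *)
Section copying_adversary.
Context {d dE : measure_display} {T : measurableType d} {E : measurableType dE}.
Context {K : nat} (N : {set 'I_K}) (j : {k : 'I_K | k \in N}).

Definition copy_strategy t : history (E := E) N t -> 'I_K -> E :=
  if t is s.+1 then fun y _ => y ord_max j else fun _ _ => point.

Lemma copy_strategyP : is_strategy copy_strategy.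
Proof.
move=> [|t] k A mA /=.
  exact: (@sigma_of_cst _ E _ (history (E := E) N 0) setT
    (fun (i : 'I_0 * {k : 'I_K | k \in N}) y => y i.1 i.2)).
by apply: sub_sigma_algebra; exists (ord_max, j) => //; exists A => //; rewrite setTI.
Qed.

Lemma attack_copy x k t : k \notin N -> attack copy_strategy x t.+1 k = x t.+1 (val j).
Proof. by rewrite /attack => /negbTE ->. Qed.

End copying_adversary.

Lemma measurable_exists {d} {T : measurableType d} (J : finType) (A : {set J})
    (S : J -> set T) :
  (forall j, j \in A -> measurable (S j)) -> measurable [set w | exists2 j, j \in A & S j w].
Proof.
move=> mS; rewrite (_ : mkset _ = \bigcup_(j in [set j | j \in A]) S j).
  by apply: fin_bigcup_measurable => //; exact: finite_finset.
by apply/seteqP; split => w [j jA Sj]; exists j.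
Qed.

Lemma probability_exists_le {R : realType} {d} {T : measurableType d}
    (P : probability T R) (J : finType) (A : {set J}) (S : J -> set T) :
  (forall j, j \in A -> measurable (S j)) ->
  P [set w | exists2 j, j \in A & S j w] <= \sum_(j in A) P (S j).
Proof.
move=> mS; rewrite -big_enum/=.
have -> : [set w | exists2 j, j \in A & S j w] = [set w | exists2 j, j \in enum A & S j w].
  by apply/seteqP; split => w [j jA Sj]; exists j => //; move: jA; rewrite mem_enum.
have {}mS j : j \in enum A -> measurable (S j) by rewrite mem_enum; exact: mS.
suff [] : measurable [set w | exists2 j, j \in enum A & S j w] /\
  P [set w | exists2 j, j \in enum A & S j w] <= \sum_(j <- enum A) P (S j) by [].
elim: (enum A) mS => [|j s IH] mS.
  rewrite (_ : mkset _ = set0) ?measure0 ?big_nil//.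
  by apply/seteqP; split => // w [].
have [ms Ps] : measurable [set w | exists2 j, j \in s & S j w] /\
    P [set w | exists2 j, j \in s & S j w] <= \sum_(j <- s) P (S j).
  by apply: IH => k ks; apply: mS; rewrite inE ks orbT.
have mj : measurable (S j) by apply: mS; rewrite mem_head.
have -> : [set w | exists2 k, k \in j :: s & S k w] =
    S j `|` [set w | exists2 k, k \in s & S k w].
  apply/seteqP; split => w /=.
    by move=> [k]; rewrite inE => /predU1P[->|ks] Sk; [left|right; exists k].
  by move=> [Sj|[k ks Sk]]; [exists j; rewrite ?mem_head|exists k; rewrite ?inE ?ks ?orbT].
split; first exact: measurableU.
by rewrite big_cons; apply: le_trans (measureU2 _ mj ms) _; rewrite leeD2l.
Qed.

(** * Bounds on the false alarm time and on the worst delay *)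

Section detection_bounds.
Context {R : realType} {d dE : measure_display}.
Context {Omega : measurableType d} {E : measurableType dE}.
Variables (K M L : nat) (N B : {set 'I_K}).
Variables (lambda : {sigma_finite_measure set E -> \bar R}) (f g : E -> R).
Variables (X : Omega -> nat -> 'I_K -> E) (P : option nat -> probability Omega R).
Hypotheses (MK : (M < K)%N) (cN : #|N| = (K - M)%N) (BN : B \subset N).
Hypothesis MLK : (M < L <= K)%N.
Hypotheses (df : is_density lambda f) (dg : is_density lambda g).
Hypotheses (KL0 : 0 < KL lambda f g) (KLy : KL lambda f g < +oo).
Hypothesis mX : forall t k, (0 < t)%N -> k \in N ->
  measurable_fun setT (fun w => X w t k).
Hypothesis lawX : forall nu, honest_law N lambda f g X B nu (P nu).

Let I := fine (KL lambda f g).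
Let rho := mean_excess lambda f g.
Let Q (c : R) := (16 + c ^+ 2 * expR c)%R.

Let I_gt0 : (0 < I)%R.
Proof. by rewrite fine_gt0// KL0. Qed.

Let mllr : measurable_fun setT (llr f g). Proof. exact: measurable_llr df dg. Qed.

Let indX nu : mutually_independent (P nu)
  [set i : nat * 'I_K | (0 < i.1)%N && (i.2 \in N)] (fun i w => X w i.1 i.2).
Proof. by case: (lawX nu). Qed.

Let law_none k : k \in N -> law_after X (P None) lambda k 0 f.
Proof. by move=> kN t A t0 mA; rewrite (lawX None).2. Qed.

Let law_changed nu k : k \in B -> law_after X (P (Some nu)) lambda k nu g.
Proof.
move=> kB t A nt mA; rewrite (lawX (Some nu)).2 ?kB ?nt//.
  exact: leq_ltn_trans nt.
exact: (fintype.subsetP BN).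
Qed.

Let law_unchanged nu k : k \in N -> k \notin B -> law_after X (P (Some nu)) lambda k 0 f.
Proof. by move=> kN kB t A t0 mA; rewrite (lawX (Some nu)).2// (negbTE kB). Qed.

Let rho_ge0 c : (0 <= rho c)%R.
Proof.
apply/fine_ge0/integral_ge0 => x _.
by rewrite lee_fin mulr_ge0 ?le_max ?lexx ?orbT//; case: dg.
Qed.

Let sigma h w := alarm_honest f g N (L - M) h (X w).
Let rank_ok : (0 < L - M <= #|N|)%N. Proof. exact: honest_rank. Qed.

Let sigma_natural h w : natural_valued (sigma h w).
Proof. exact: alarm_honest_natural. Qed.

Let msigma h n : measurable [set w | sigma h w <= n%:R%:E].
Proof. exact: measurable_alarm_honest. Qed.

Let malarm h n k : k \in N -> measurable [set w | alarm f g h k (X w) <= n%:R%:E].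
Proof. by move=> kN; exact: (measurable_sensor_alarm mX df dg h n kN). Qed.

(** Since the probability of an honest alarm by time n is at most |N| (n + 1)
    e^{-h}, Markov's inequality gives gamma >= (n + 1) (1 - |N| (n + 1)
    e^{-h}). *)
Lemma log_false_alarm_ge h gamma : (0 < h)%R -> (1 < gamma)%R ->
  \int[P None]_w sigma h w = gamma%:E -> (h <= ln gamma + ln (8 * #|N|%:R))%R.
Proof.
move=> h0 g1 sg; set c : R := #|N|%:R.
have c1 : (1 <= c)%R by rewrite ler1n cN subn_gt0.
have bound n : (n.+1%:R * (1 - c * (n.+1%:R / expR h)) <= gamma)%R.
  rewrite -lee_fin -sg.
  apply: le_trans (integral_natural_valued_ge (P None) (sigma_natural h) (msigma h) n).
  rewrite EFinM lee_wpmul2l ?lee_fin//.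
  rewrite set_ltNle probability_setC// EFinB leeB//.
  apply: (@le_trans _ _ (\sum_(k in N) (n.+1%:R / expR h)%:E)); last first.
    by rewrite sumEFin sumr_const -[in leLHS](mulr_natl (_ / _)) lexx.
  apply: (@le_trans _ _ (\sum_(k in N) P None [set w | alarm f g h k (X w) <= n%:R%:E])); last first.
    apply: lee_sum => k kN.
    apply: (alarm_early_null mX (indX None) df dg n kN (law_none kN) (ltW h0)).
  apply: le_trans (probability_exists_le (P None) (malarm h n)).
  apply: le_measure; rewrite ?inE//.
    by apply: measurable_exists; exact: malarm.
  move=> w /=; rewrite /sigma alarm_honest_leP// => /(leq_trans (andP rank_ok).1).
  by rewrite card_gt0 => /set0Pn[k]; rewrite inE => /andP[kN hk]; exists k.
have gp : (0 < gamma)%R by lra.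
rewrite -lnM ?posrE ?mulr_gt0//; [|lra..].
rewrite -[leLHS]expRK ler_ln ?posrE ?expR_gt0 ?mulr_gt0//; [|lra..].
have e0 := expR_gt0 h.
(* For n + 1 close to x, an early alarm has probability at most one half. *)
pose x := (expR h / (2 * c))%R.
have x0 : (0 < x)%R by rewrite divr_gt0//; lra.
have hx : expR h = (x * (2 * c))%R by rewrite divfK// gt_eqF//; lra.
have [x1|x1] := ltP x 1%R.
  by rewrite hx; nra.
have /andP[tx xt] := truncn_itv (ltW x0).
case tE : (Num.truncn x) tx xt => [|n] tx xt; first by lra.
have := bound n; rewrite hx.
have -> : (c * (n.+1%:R / (x * (2 * c))) = n.+1%:R / (2 * x))%R.
  by field; rewrite !gt_eqF//; lra.
have : (n.+1%:R / (2 * x) <= 2^-1 :> R)%R.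
  by rewrite invfM mulrCA -[leRHS]mulr1 ler_wpM2l ?ler_pdivrMr ?mul1r//; lra.
have : (x <= 2 * n.+1%:R)%R.
  have xt' : (x < n.+1%:R + 1)%R by rewrite natr1.
  have : (1 <= n.+1%:R :> R)%R by rewrite ler1n.
  lra.
set y : R := (n.+1%:R / _)%R; set m : R := n.+1%:R => xm y2 my.
have m0 : (0 <= m)%R by rewrite ler0n.
have m2 : (m * 2^-1 <= gamma)%R.
  by apply: le_trans my; rewrite ler_wpM2l//; lra.
have x4 : (x <= 4 * gamma)%R by lra.
have : (x * c <= 4 * gamma * c)%R by rewrite ler_wpM2r//; lra.
lra.
Qed.

Hypothesis LB : (L <= #|B|)%N.

Let B_rank : (0 < L - M)%N && (L - M <= #|B|)%N.
Proof. by case/andP: rank_ok => -> _; rewrite (leq_trans (leq_subr _ _)). Qed.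

Let kN k : k \in B -> k \in N. Proof. exact: (fintype.subsetP BN). Qed.

Let L_gt0 : (0 < L)%N. Proof. by case/andP: MLK => /(leq_ltn_trans _)->. Qed.

Let mlate h n k : k \in N -> measurable [set w | n%:R%:E < alarm f g h k (X w)].
Proof.
by move=> kN'; rewrite set_ltNle; exact/measurableC/malarm.
Qed.

(** The (L - M)-th honest alarm is not later than the last alarm in B, hence
    than the sum of the alarm times in B; each of them has mean at most of
    order e^{(1 + th) h}. *)
Lemma false_alarm_le (th : R) : (0 < th)%R ->
  exists2 C, (0 < C)%R & forall h gamma, (0 < h)%R ->
    \int[P None]_w sigma h w = gamma%:E -> (gamma <= C * expR ((1 + th) * h))%R.
Proof.
move=> th0; have d0 : (0 < th * I / (2 * (1 + th)))%R.
  by rewrite divr_gt0 ?mulr_gt0//; lra.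
have [c c0 /andP[_ rc]] := mean_excess_small df dg KLy d0.
pose kappa := (th * I / 2)%R.
have k0 : (0 < kappa)%R by rewrite divr_gt0 ?mulr_gt0.
have kle : (0 <= kappa <= th * I - (1 + th) * rho c)%R.
  rewrite (ltW k0)/=.
  have : ((1 + th) * rho c <= (1 + th) * (th * I / (2 * (1 + th))))%R.
    by rewrite ler_wpM2l//; lra.
  have -> : ((1 + th) * (th * I / (2 * (1 + th))) = kappa)%R.
    by rewrite /kappa; field; rewrite gt_eqF//; lra.
  rewrite /kappa; lra.
have B0 : (0 < #|B|%:R :> R)%R by rewrite ltr0n (leq_trans L_gt0).
exists (#|B|%:R * expR ((1 + th) * c) / kappa)%R.
  by rewrite !mulr_gt0 ?expR_gt0 ?invr_gt0.
move=> h gamma h0 sg; rewrite -lee_fin -sg.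
apply: (integral_natural_valued_le (sigma_natural h) (msigma h) measurableT) => m.
apply: (@le_trans _ _ (\sum_(0 <= n < m) \sum_(k in B)
    P None [set w | n%:R%:E < alarm f g h k (X w)])).
  apply: lee_sum => n _; rewrite setTI.
  apply: le_trans (probability_exists_le (P None) (fun k kB => mlate h n (kN kB))).
  apply: le_measure; rewrite ?inE.
  - exact: (measurable_tail (msigma h)).
  - by apply: measurable_exists => k kB; exact: (mlate h n (kN kB)).
  move=> w /= late; apply: contrapT => none; move: late; rewrite ltNge => /negP; apply.
  case/andP: B_rank => r0 rB; apply: (alarm_honest_le_changed r0 rB BN) => k kB.
  by rewrite leNgt; apply/negP => late; apply: none; exists k.
rewrite exchange_big/=.
apply: (@le_trans _ _ (\sum_(k in B) (expR ((1 + th) * h) * expR ((1 + th) * c) / kappa)%:E)).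
  apply: lee_sum => k kB; rewrite EFinM lee_pdivlMr// muleC.
  apply: (survival_sum_null mX (indX None) df dg KLy m (kN kB) (law_none (kN kB))) => //.
    exact: ltW.
  exact: ltW.
rewrite sumEFin sumr_const lee_fin -[leLHS]mulr_natl le_eqVlt; apply/orP; left.
by apply/eqP; ring.
Qed.

(** The rate r bounds the mean of the inverse tilt of a changed sensor, and
    should be thought of as e^{- th (I - delta)}. *)
Section conditional_delay.
Variables (h th c : R) (nu : nat) (pi : forall t, history (E := E) N t -> 'I_K -> E).
Hypotheses (h0 : (0 < h)%R) (th0 : (0 < th <= 2^-1)%R) (c0 : (0 <= c)%R).
Variable r : R.
Hypothesis r01 : (0 < r < 1)%R.
Hypothesis rle : (1 - th * (I - rho c) + th ^+ 2 * Q c <= r)%R.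
Hypothesis spi : is_strategy pi.

Let alarm_time w := alarm_all f g L h (attack pi (X w)).
Let delay w := maxe (alarm_time w - nu%:R%:E) 0.

Let LK : (0 < L <= K)%N. Proof. by case/andP: MLK => _ ->; rewrite L_gt0. Qed.

Let alarm_time_natural w : natural_valued (alarm_time w).
Proof. exact: alarm_all_natural. Qed.

Let delay_natural w : natural_valued (delay w).
Proof.
rewrite /delay; case: (alarm_time_natural w) => [->|[n ->]]; first by left.
right; exists (n - nu)%N; rewrite -EFinB -EFin_max; congr (_%:E).
have [nnu|nnu] := leqP nu n.
  by rewrite natrB// max_l// subr_ge0 ler_nat.
by rewrite (eqP (ltnW nnu : (n - nu == 0)%N)) max_r// subr_le0 ler_nat ltnW.
Qed.

Let delay_le w (n : nat) : (delay w <= n%:R%:E) = (alarm_time w <= (nu + n)%N%:R%:E).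
Proof.
rewrite /delay ge_max lee_fin ler0n andbT leeBlDr// natrD EFinD addeC.
by rewrite addeC.
Qed.

Let mdelay n : measurable [set w | delay w <= n%:R%:E].
Proof.
rewrite (_ : mkset _ = [set w | alarm_time w <= (nu + n)%N%:R%:E]).
  exact: (measurable_alarm_attack h MLK mX mllr).
by apply/seteqP; split => w /=; rewrite delay_le.
Qed.

(** If the L-th alarm is late, so is that of some sensor in B, because |B| >=
    L. Tail probabilities are bounded by 1 before n0 and by a geometric series
    from n0 on; n0 close to h / (I - delta) is where the latter becomes less
    than a constant. *)
Lemma integral_delay_le n0 (A : set Omega) :
  sigma_of (past N nu) (fun i w => X w i.1 i.2) A ->
  \int[P (Some nu)]_(w in A) delay w <=
  (n0%:R + #|B|%:R * (expR (th * h) * r ^+ n0 / (1 - r)))%:E * P (Some nu) A.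
Proof.
move=> sA; have /andP[r0 r1] := r01.
have mA : measurable A.
  by apply: sigma_of_measurable sA => -[s i] /= /andP[/andP[s0 _] iN]; exact: mX.
apply: (integral_natural_valued_le delay_natural mdelay mA) => m.
pose a n : R := (if (n < n0)%N then 1 else #|B|%:R * (expR (th * h) * r ^+ n))%R.
have tail n : P (Some nu) (A `&` [set w | n%:R%:E < delay w]) <=
    (a n)%:E * P (Some nu) A.
  rewrite /a; case: ifP => _.
    rewrite mul1e; apply: le_measure; rewrite ?inE//.
    by apply: measurableI => //; exact: (measurable_tail mdelay).
  apply: (@le_trans _ _ (\sum_(k in B)
      P (Some nu) (A `&` [set w | (nu + n)%N%:R%:E < alarm f g h k (X w)]))).
    apply: le_trans (probability_exists_le (P (Some nu)) _); last first.
      by move=> k kB; apply: measurableI => //; exact: (mlate h _ (kN kB)).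
    apply: le_measure; rewrite ?inE.
    - by apply: measurableI => //; exact: (measurable_tail mdelay).
    - apply: measurable_exists => k kB; apply: measurableI => //.
      exact: (mlate h _ (kN kB)).
    move=> w /= [Aw]; rewrite ltNge delay_le => /negP late.
    apply: contrapT => none; apply: late.
    apply: (alarm_all_le_changed L_gt0 LB) => k kB; rewrite leNgt alarm_attack ?kN//.
    by apply/negP => late; apply: none; exists k.
  apply: (@le_trans _ _ (\sum_(k in B) (expR (th * h) * r ^+ n)%:E * P (Some nu) A)).
    apply: lee_sum => k kB.
    exact: (delay_tail_changed mX (indX _) df dg KLy n (kN kB) (law_changed kB)
      h0 th0 c0 (ltW r0) rle sA).
  rewrite -ge0_sume_distrl; last first.
    by move=> k _; rewrite lee_fin mulr_ge0 ?expR_ge0 ?exprn_ge0// ltW.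
  by rewrite sumEFin sumr_const -[in leLHS](mulr_natl (_ * _)).
apply: (@le_trans _ _ (\sum_(0 <= n < m) (a n)%:E * P (Some nu) A)).
  by apply: lee_sum => n _.
have a0 n : (0 <= a n)%R.
  by rewrite /a; case: ifP => // _; rewrite !mulr_ge0 ?expR_ge0 ?exprn_ge0// ltW.
rewrite -ge0_sume_distrl; last by move=> n _; rewrite lee_fin.
rewrite lee_wpmul2r// sumEFin lee_fin.
have split_sum : (\sum_(0 <= n < n0 + m) a n <=
    n0%:R + #|B|%:R * (expR (th * h) * r ^+ n0 / (1 - r)))%R.
  rewrite (big_cat_nat (n := n0))//= ?leq_addr//.
  rewrite (eq_big_nat _ _ (F2 := fun=> 1%R)); last first.
    by move=> n /andP[_ nn0]; rewrite /a nn0.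
  rewrite sumr_const_nat subn0 lerD2l.
  rewrite (eq_big_nat _ _ (F2 := fun n => #|B|%:R * (expR (th * h) * r ^+ n))%R); last first.
    by move=> n /andP[nn0 _]; rewrite /a ltnNge nn0.
  rewrite -mulr_sumr ler_wpM2l// -mulr_sumr -mulrA ler_wpM2l ?expR_ge0//.
  rewrite ler_pdivlMr ?subr_gt0//.
  rewrite -{1}[n0]add0n big_addn addKn.
  have -> : ((\sum_(0 <= i < m) r ^+ (i + n0)) * (1 - r) = r ^+ n0 - r ^+ (m + n0))%R.
    elim: (m) => [|p IH]; first by rewrite big_nil mul0r subrr.
    by rewrite big_nat_recr//= mulrDl IH addSn exprS; ring.
  by rewrite gerBl exprn_ge0// ltW.
apply: le_trans split_sum.
rewrite [leRHS](big_cat_nat (n := m))//= ?leq_addl// lerDl.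
by apply: sumr_ge0.
Qed.

End conditional_delay.

Lemma worst_delay_le (delta : R) : (0 < delta < I)%R ->
  exists C, forall h, (0 < h)%R ->
    worst_delay N X P (alarm_all f g L h) <= (h / (I - delta) + C)%:E.
Proof.
move=> /andP[d0 dI].
have [c c0 /andP[_ rc]] := mean_excess_small df dg KLy (divr_gt0 d0 (ltr0n R 2)).
have Q0 : (0 < Q c)%R by rewrite /Q ltr_wpDr// mulr_ge0 ?sqr_ge0 ?expR_ge0.
(* With this th, the truncation and the quadratic term each lower the
   exponential rate by at most delta / 2. *)
pose th := Num.min 2^-1%R (delta / (4 * Q c))%R.
have th0 : (0 < th)%R by rewrite lt_min invr_gt0 ltr0n/= divr_gt0// mulr_gt0.
have th12 : (th <= 2^-1)%R by rewrite ge_min lexx.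
have thQ : (th * Q c <= delta / 4)%R.
  have : (th <= delta / (4 * Q c))%R by rewrite ge_min lexx orbT.
  by rewrite invfM mulrA ler_pdivlMr.
have Id : (0 < I - delta)%R by rewrite subr_gt0.
pose r := expR (- (th * (I - delta))).
have r01 : (0 < r < 1)%R.
  by rewrite expR_gt0 /= expR_lt1 oppr_lt0 mulr_gt0.
have rle : (1 - th * (I - rho c) + th ^+ 2 * Q c <= r)%R.
  apply: le_trans (expR_ge1Dx _).
  have : (th * (rho c + th * Q c) <= th * delta)%R.
    by rewrite ler_wpM2l ?(ltW th0)//; rewrite /rho; lra.
  rewrite expr2; lra.
exists (1 + #|B|%:R / (1 - r))%R => h h0.
set c' := (h / _ + _)%R.
(* From this n0 on, r ^+ n0 compensates expR (th * h). *)
pose n0 := (Num.truncn (h / (I - delta))).+1.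
have x0 : (0 <= h / (I - delta))%R by rewrite divr_ge0 ?(ltW h0) ?(ltW Id).
have /andP[tx xt] := truncn_itv x0.
have bound : (n0%:R + #|B|%:R * (expR (th * h) * r ^+ n0 / (1 - r)) <= c')%R.
  rewrite /c' addrA; apply: lerD.
    by rewrite /n0 -natr1 lerD2r.
  rewrite ler_wpM2l// -[leRHS]mul1r ler_wpM2r ?invr_ge0 ?subr_ge0 ?(ltW (andP r01).2)//.
  rewrite /r -expRM_natl -expRD -[leRHS]expR0 ler_expR.
  have : (h <= n0%:R * (I - delta))%R by rewrite -ler_pdivrMr// ltW.
  move=> /(ler_wpM2l (ltW th0)); lra.
have c'0 : (0 <= c')%R.
  apply: le_trans bound; rewrite addr_ge0// mulr_ge0// divr_ge0 ?mulr_ge0 ?expR_ge0//.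
    by rewrite exprn_ge0// expR_ge0.
  by rewrite subr_ge0 ltW; case/andP: r01.
apply: ge_ereal_sup => _ [nu [pi [Y [spi cY ->]]]].
apply: (ess_sup_cond_exp_le _ cY c'0) => A GA.
  apply: (sigma_of_measurable _ (sigma_of_attack spi GA)).
  by move=> -[s i] /= /andP[/andP[s0 _] iN]; exact: mX.
have th01 : (0 < th <= 2^-1)%R by rewrite th0.
apply: (le_trans (integral_delay_le h0 th01 c0 r01 rle spi n0 (sigma_of_attack spi GA))).
by rewrite lee_wpmul2r// lee_fin.
Qed.

(** A change at time 0 against an adversary that copies an honest sensor. The
    past at time 0 is trivial, so that the conditional expectation is the
    constant equal to the mean of the L-th alarm, which is not earlier than the
    first honest alarm. *)
Lemma worst_delay_ge_probability h n (q : R) : (0 < h)%R ->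
  (forall k, k \in N -> P (Some 0%N) [set w | alarm f g h k (X w) <= n%:R%:E] <= q%:E) ->
  (n.+1%:R * (1 - #|N|%:R * q))%:E <= worst_delay N X P (alarm_all f g L h).
Proof.
move=> h0 Pq.
have /set0Pn[j0 j0N] : N != finset.set0 by rewrite -card_gt0 cN subn_gt0.
pose pi := copy_strategy (E := E) (exist _ j0 j0N : {k : 'I_K | k \in N}).
have spi : is_strategy pi by exact: copy_strategyP.
have LK : (0 < L <= K)%N by case/andP: MLK => _ ->; rewrite L_gt0.
pose alarm_time w := alarm_all f g L h (attack pi (X w)).
have nA w : natural_valued (alarm_time w) by exact: alarm_all_natural.
have mA m : measurable [set w | alarm_time w <= m%:R%:E].
  exact: (measurable_alarm_attack h MLK mX mllr).
have A0 w : 0 <= alarm_time w by exact: natural_valued_ge0.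
pose c := \int[P (Some 0%N)]_w alarm_time w.
have P1 : P (Some 0%N) setT = 1 by exact: probability_setT.
have copied k w : exists2 k', k' \in N &
    alarm f g h k (attack pi (X w)) = alarm f g h k' (X w).
  have [kN'|kN'] := boolP (k \in N); first by exists k => //; exact: alarm_attack.
  by exists j0 => //; apply: eq_alarm => -[//|s] _; exact: attack_copy.
apply: (@le_trans _ _ c).
  apply: le_trans (integral_natural_valued_ge (P (Some 0%N)) nA mA n).
  rewrite EFinM lee_wpmul2l ?lee_fin//.
  rewrite set_ltNle probability_setC// EFinB leeB//.
  apply: (@le_trans _ _ (\sum_(k in N) P (Some 0%N) [set w | alarm f g h k (X w) <= n%:R%:E])).
    apply: le_trans (probability_exists_le (P (Some 0%N)) (malarm h n)).
    apply: le_measure; rewrite ?inE//.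
      by apply: measurable_exists; exact: malarm.
    move=> w /=; rewrite /alarm_time alarm_all_leP// => /(leq_trans L_gt0).
    rewrite card_gt0 => /set0Pn[k]; rewrite inE => hk.
    by have [k' k'N kk'] := copied k w; exists k' => //; rewrite -kk'.
  apply: (@le_trans _ _ (\sum_(k in N) q%:E)); first by apply: lee_sum => k /Pq.
  by rewrite sumEFin sumr_const lee_fin -[leLHS]mulr_natl.
apply: ereal_sup_ubound; exists 0%N, pi, (cst c); split => //; last first.
  by rewrite ess_sup_cst// [X in 0 < X]P1.
split => [w|D mD|A GA]; first exact: integral_ge0.
  exists (fun _ => D c); first exact: sigma_of_cst.
  by rewrite setTI; apply/seteqP; split.
have {GA}[->|->] : A = set0 \/ A = setT.
  have := sigma_of_attack spi GA.
  apply: (smallest_sub (X := [set A | A = set0 \/ A = setT])).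
    split; first by left.
      by move=> U [->|->]; rewrite ?setD0 ?setDv; [right|left].
    move=> F FU; have [[m Fm]|none] := pselect (exists m, F m = setT).
      by right; apply/seteqP; split => // w _; exists m => //; rewrite Fm.
    left; apply/seteqP; split => // w [m _]; have [->//|FmT] := FU m.
    by case: none; exists m.
  by move=> U [[s k] /= /andP[/andP[s0 s1] _] _]; have := leq_trans s0 s1.
  by rewrite !integral_set0.
rewrite integral_cst// [X in _ * X]P1 mule1.
by apply: eq_integral => w _; rewrite sube0 (max_l (A0 w)).
Qed.

(** With n the integer part of (1 - e) h / I, the probability of an alarm by
    time n is at most e / |N| for each honest sensor when h is large. For a
    changed sensor this is alarm_early_changed, the two terms of which are kept
    below half of that value each. *)
Lemma worst_delay_ge (eps : R) : (0 < eps < 1)%R ->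
  exists2 H, (0 < H)%R & forall h, (H <= h)%R ->
    ((1 - eps) * (h / I))%:E <= worst_delay N X P (alarm_all f g L h).
Proof.
move=> /andP[eps0 eps1].
pose e := (eps / 2)%R; have e0 : (0 < e)%R by rewrite divr_gt0.
have e1 : (e < 2^-1)%R by rewrite /e; lra.
have N0 : (0 < #|N|%:R :> R)%R by rewrite ltr0n cN subn_gt0.
pose z := (e / #|N|%:R)%R; have z0 : (0 < z)%R by exact: divr_gt0.
have z20 : (0 < z / 2)%R by exact: divr_gt0.
have rc0 : (0 < z * (e / 4) * I / 2)%R by rewrite !mulr_gt0// ?invr_gt0// divr_gt0.
have [c c0 /andP[_ rc]] := mean_excess_small df dg KLy rc0.
have Q0 : (0 < Q c)%R by rewrite /Q ltr_wpDr// mulr_ge0 ?sqr_ge0 ?expR_ge0.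
(* The growth rate th * I + th ^+ 2 * Q c is then at most th * I * (1 + e / 2).
   As (1 - e) * (1 + e / 2) <= 1 - e / 2, the statistic has grown by time n to
   expR (th * (1 - e / 2) * h), whereas the level to cross is expR (th * (1 - e
   / 4) * h). *)
pose th := Num.min 2^-1%R (e * I / (2 * Q c))%R.
have th0 : (0 < th)%R by rewrite lt_min invr_gt0 ltr0n/= divr_gt0// mulr_gt0.
have th12 : (th <= 2^-1)%R by rewrite ge_min lexx.
have thQ : (th * Q c <= e * I / 2)%R.
  have : (th <= e * I / (2 * Q c))%R by rewrite ge_min lexx orbT.
  by rewrite invfM mulrA ler_pdivlMr.
have Iinv : (0 <= I^-1)%R by rewrite invr_ge0 ltW.
have the0 : (0 < th * (e / 4))%R by rewrite mulr_gt0// divr_gt0.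
have [H1 H11 hH1] := affine_le_exp Iinv (ltr01 : (0 < 1)%R) z0.
have [H2 H21 hH2] := affine_le_exp Iinv the0 z20.
exists (Num.max H1 H2); first by rewrite lt_max; apply/orP; left; lra.
move=> h; rewrite ge_max => /andP[/hH1 {}hH1 hH2']; have {}hH2 := hH2 h hH2'.
have h0 : (0 < h)%R by lra.
pose y := ((1 - e) * (h / I))%R.
have hI0 : (0 < h / I)%R by exact: divr_gt0.
have y0 : (0 <= y)%R by rewrite mulr_ge0 ?(ltW hI0)//; lra.
have yh : (y <= h / I)%R by rewrite ler_piMl ?(ltW hI0)//; lra.
have /andP[tx xt] := truncn_itv y0; set n := Num.truncn y in tx xt.
have nh : (n.+1%:R <= I^-1 * h + 1)%R by rewrite -natr1 mulrC; lra.
have early k : k \in N ->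
    P (Some 0%N) [set w | alarm f g h k (X w) <= n%:R%:E] <= z%:E.
  move=> kN'; have [kB|kB] := boolP (k \in B); last first.
    apply: (le_trans (alarm_early_null mX (indX _) df dg n kN' (law_unchanged 0%N kN' kB) (ltW h0))).
    rewrite lee_fin ler_pdivrMr ?expR_gt0//; move: hH1; rewrite mul1r; lra.
  have th01 : (0 < th <= 2^-1)%R by rewrite th0.
  have eta01 : (0 < e / 4 < 1)%R by rewrite divr_gt0//=; lra.
  apply: (le_trans (alarm_early_changed mX (indX _) df dg KLy n kN'
    (law_changed kB) KL0 h0 th01 c0 eta01)).
  rewrite lee_fin -/I -/rho -/(Q c) [leRHS]splitr; apply: lerD; last first.
    rewrite ler_pdivrMr; last by rewrite mulr_gt0// divr_gt0.
    have : (n%:R * rho c <= h / I * (z * (e / 4) * I / 2))%R.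
      by rewrite ler_pM ?(le_trans tx)//; exact: rho_ge0.
    have -> : (h / I * (z * (e / 4) * I / 2) = z / 2 * (e / 4 * h))%R.
      by field; rewrite gt_eqF.
    by [].
  rewrite ler_pdivrMr ?expR_gt0//.
  have aexp : ((1 + th * I + th ^+ 2 * Q c) ^+ n <= expR (th * ((1 - e / 2) * h)))%R.
    apply: (@le_trans _ _ (expR (th * (I + th * Q c)) ^+ n)%R).
      apply: lerXn2r; rewrite ?nnegrE ?expR_ge0//.
        by rewrite !addr_ge0 ?mulr_ge0 ?sqr_ge0 ?(ltW th0) ?(ltW Q0) ?(ltW I_gt0).
      by apply: le_trans (expR_ge1Dx _); rewrite le_eqVlt; apply/orP; left; apply/eqP; ring.
    rewrite -expRM_natl ler_expR mulrCA ler_wpM2l ?(ltW th0)//.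
    apply: (@le_trans _ _ (y * (I * (1 + e / 2)))%R).
      by rewrite ler_pM// ?addr_ge0 ?mulr_ge0 ?(ltW th0) ?(ltW Q0) ?(ltW I_gt0)//; lra.
    have -> : (y * (I * (1 + e / 2)) = (1 - e) * (1 + e / 2) * h)%R.
      by rewrite /y; field; rewrite gt_eqF.
    by rewrite ler_wpM2r ?(ltW h0)//; nra.
  apply: (@le_trans _ _ ((I^-1 * h + 1) * expR (th * ((1 - e / 2) * h)))%R).
    apply: ler_pM => //; rewrite exprn_ge0// !addr_ge0// ?mulr_ge0// ?sqr_ge0// ?(ltW th0)// ?(ltW Q0)// ?(ltW I_gt0)//.
  apply: (@le_trans _ _ (z / 2 * expR (th * (e / 4) * h) * expR (th * ((1 - e / 2) * h)))%R).
    by rewrite ler_wpM2r ?expR_ge0.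
  rewrite -mulrA -expRD le_eqVlt; apply/orP; left; apply/eqP.
  by congr (_ * expR _)%R; field.
apply: le_trans (worst_delay_ge_probability h0 early).
rewrite lee_fin.
have -> : (#|N|%:R * z = e)%R by rewrite /z mulrC divfK// gt_eqF.
apply: (@le_trans _ _ (y * (1 - e)))%R; last by rewrite ler_wpM2r ?(ltW xt)//; lra.
rewrite /y mulrAC ler_wpM2r ?(ltW hI0)//.
have : (eps = 2 * e)%R by rewrite /e; field.
nra.
Qed.

(** By the previous bounds, log gamma and h differ by a small proportion of h
    and a constant, and so do h / I and the delay. A is so large that the
    constants amount to at most (eps / 2) log gamma. *)
Lemma worst_delay_between (eps : R) : (0 < eps < 1)%R ->
  exists2 A, (0 < A)%R & forall h gamma, (0 < h)%R -> (1 < gamma)%R ->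
    \int[P None]_w sigma h w = gamma%:E -> (A <= ln gamma)%R ->
    ((1 - eps) * (ln gamma / I))%:E <= worst_delay N X P (alarm_all f g L h) <=
    ((1 + eps) * (ln gamma / I))%:E.
Proof.
move=> /andP[eps0 eps1].
have delta01 : (0 < I * (eps / 4) < I)%R.
  by rewrite mulr_gt0 ?divr_gt0//= gtr_pMr//; lra.
have [C1 upper] := worst_delay_le delta01.
have e401 : (0 < eps / 4 < 1)%R by rewrite divr_gt0//=; lra.
have [H H0 lower] := worst_delay_ge e401.
have [C C0 hC] := false_alarm_le (divr_gt0 eps0 (ltr0n R 4)).
pose c2 : R := ln (8 * #|N|%:R).
exists (2 / eps * (2 * `|c2| + `|C1| * I + `|ln C| + 2 * H) + 1)%R.
  rewrite ltr_wpDl// mulr_ge0//; first by rewrite divr_ge0// ltW.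
  by rewrite !addr_ge0 ?mulr_ge0 ?(ltW H0) ?(ltW I_gt0).
move=> h gamma h0 g1 sg; set A := (2 * `|c2| + _ + _ + _)%R => lnA.
have {lnA} : (A <= eps / 2 * ln gamma)%R.
  have : (eps / 2 * (2 / eps * A + 1) <= eps / 2 * ln gamma)%R.
    by rewrite ler_wpM2l// divr_ge0// ltW.
  have -> : (eps / 2 * (2 / eps * A + 1) = A + eps / 2)%R by field; rewrite gt_eqF.
  lra.
rewrite /A; have := normr_ge0 c2; have := ler_norm c2; set a2 := `|c2|%R.
have : (0 <= `|C1| * I)%R by rewrite mulr_ge0// ltW.
have : (C1 * I <= `|C1| * I)%R by rewrite ler_wpM2r ?ler_norm// ltW.
set a1 := (`|C1| * I)%R.
have := normr_ge0 (ln C); have := ler_norm (ln C); set a3 := `|ln C|%R.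
set l := ln gamma => a31 a30 a11 a10 a21 a20 big.
have l0 : (0 <= l)%R by nra.
apply/andP; split.
  have lh : (l <= ln C + (1 + eps / 4) * h)%R.
    rewrite -[X in (_ + X)%R]expRK -lnM ?posrE ?expR_gt0// ler_ln ?posrE ?mulr_gt0 ?expR_gt0//.
      exact: hC.
    lra.
  have Hh : (H <= h)%R by nra.
  apply: le_trans (lower h Hh); rewrite lee_fin !mulrA ler_wpM2r ?invr_ge0 ?(ltW I_gt0)//.
  have : ((1 - eps / 4) * l <= (1 - eps / 4) * (ln C + (1 + eps / 4) * h))%R.
    by rewrite ler_wpM2l//; lra.
  have : ((1 - eps / 4) * ln C <= a3)%R by nra.
  nra.
apply: (le_trans (upper h h0)); rewrite lee_fin.
have hl : (h <= l + c2)%R by exact: log_false_alarm_ge.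
have -> : (I - I * (eps / 4) = I * (1 - eps / 4))%R by ring.
have q0 : (0 < 1 - eps / 4)%R by lra.
rewrite -(@ler_pM2r _ I)// mulrDl.
have -> : (h / (I * (1 - eps / 4)) * I = h / (1 - eps / 4))%R.
  by rewrite [(I * _)%R]mulrC invfM mulrA divfK// gt_eqF.
have -> : ((1 + eps) * (l / I) * I = (1 + eps) * l)%R by field; rewrite gt_eqF.
have : (h / (1 - eps / 4) <= (1 + eps / 2) * h)%R.
  have e1 : (1 <= (1 + eps / 2) * (1 - eps / 4))%R by nra.
  by rewrite ler_pdivrMr// mulrAC ler_peMl// ltW.
move=> hh; have : ((1 + eps / 2) * h <= (1 + eps / 2) * (l + c2))%R.
  by rewrite ler_wpM2l//; lra.
have : ((1 + eps / 2) * c2 <= 2 * a2)%R by nra.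
lra.
Qed.

End detection_bounds.

(** * Delay and false alarms of the L-th alarm *)

Theorem theorem6 (R : realType) (d dE : measure_display)
    (Omega : measurableType d) (E : measurableType dE)
    (K M L : nat) (N B : {set 'I_K})
    (lambda : {sigma_finite_measure set E -> \bar R}) (f g : E -> R)
    (X : Omega -> nat -> 'I_K -> E) (P : option nat -> probability Omega R)
    (* the set of levels gamma at which a threshold h gamma is given *)
    (Gamma : set R) (h : R -> R) :
  (M < K)%N -> #|N| = (K - M)%N -> B \subset N -> (M < L <= K)%N ->
  is_density lambda f -> is_density lambda g ->
  0 < KL lambda f g < +oo ->
  (forall t k, (0 < t)%N -> k \in N ->
    measurable_fun setT (fun w => X w t k)) ->
  (forall nu, honest_law N lambda f g X B nu (P nu)) ->
  (forall gamma, Gamma gamma ->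
    [/\ (1 < gamma)%R, (0 < h gamma)%R &
        \int[P None]_w alarm_honest f g N (L - M) (h gamma) (X w) =
        gamma%:E]) ->
  (forall gamma, Gamma gamma ->
    admissible N X P gamma (alarm_all f g L (h gamma))) /\
  ((L <= #|B|)%N ->
    worst_delay N X P (alarm_all f g L (h gamma)) /
      ((ln gamma)%:E / KL lambda f g)
      @[gamma --> within Gamma +oo%R] --> 1).
Proof.
move=> MK cN BN MLK df dg /andP[KL0 KLy] mX lawX hG.
have mllr : measurable_fun setT (llr f g) by exact: measurable_llr df dg.
split=> [gamma Gg|LB].
  have [g1 h0 sg] := hG _ Gg; split.
    apply: alarm_all_stopping_time => //.
    by case/andP: MLK => ML ->; rewrite (leq_ltn_trans _ ML).
  apply: le_ereal_inf_tmp => _ [pi spi <-]; rewrite -sg.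
  exact: integral_alarm_attack_ge.
set D := fun gamma => worst_delay N X P (alarm_all f g L (h gamma)).
pose I := fine (KL lambda f g).
have KLE : KL lambda f g = I%:E by rewrite fineK// (KL_fin df dg).
have I0 : (0 < I)%R by rewrite fine_gt0// KL0.
have between eps : (0 < eps < 1)%R -> \forall gamma \near +oo%R, Gamma gamma ->
    D gamma / ((ln gamma)%:E / KL lambda f g) \is a fin_num /\
    (1 - eps <= fine (D gamma / ((ln gamma)%:E / KL lambda f g)) <= 1 + eps)%R.
  move=> /(worst_delay_between MK cN BN MLK df dg KL0 KLy mX lawX LB)[A A0 hA].
  near=> gamma => Gg.
  have [g1 h0 sg] := hG _ Gg.
  have lnA : (A <= ln gamma)%R.
    have Ag : (expR A <= gamma)%R by near: gamma; exact: nbhs_pinfty_ge.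
    have gp : (0 < gamma)%R by lra.
    by rewrite -[leLHS]expRK ler_ln// posrE expR_gt0.
  have l0 : (0 < ln gamma / I)%R by rewrite divr_gt0//; lra.
  have /andP[] := hA _ _ h0 g1 sg lnA.
  rewrite -/(D gamma) KLE -/I /inve (gt_eqF I0) -EFinM (gt_eqF l0).
  case: (D gamma) => [y| |]; rewrite ?lee_fin ?leye_eq ?leeNy_eq// => lo hi.
  rewrite -EFinM; split => //=.
  by rewrite ler_pdivlMr// lo ler_pdivrMr.
apply/fine_cvgP; split.
  have : (0 < (2^-1 : R) < 1)%R by lra.
  by move/between; apply: filterS => gamma + Gg => /(_ Gg)[].
apply/cvgrPdist_le => eps eps0.
have : (0 < Num.min eps 2^-1 < 1)%R by rewrite lt_min eps0 gt_min; lra.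
move/between; apply: filterS => gamma + Gg => /(_ Gg)[_ /andP[lo hi]] /=.
have m : (Num.min eps 2^-1 <= eps)%R by rewrite ge_min lexx.
by rewrite ler_norml; lra.
Unshelve. all: by end_near. Qed.
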